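(* Consider the problem $$\min\ f(x)+p(x)-u(x)\quad\text{s.t.}\quad g_i(x)+q_i(x)-v_i(x)\le 0,\ i=1,\ldots,m,\quad x\in\mathcal X, \qquad (P)$$ with feasible region $\mathcal F$, and let $\{(x^k,s_f^k,s_u^k,\{s_{g_i}^k\}_{i=1}^m,\{s_{v_i}^k\}_{i=1}^m)\}_{k\ge0}$ be the sequence generated by the variant of the SCP method described in the context, with $l_f^k$ and $l_{g_i}^k$ denoting the final values of these parameters at the $k$th outer iteration. Assume that $F(x):=f(x)+p(x)-u(x)$ is uniformly continuous in the level set $\mathcal L=\{x\in\mathcal F:F(x)\le F(x^0)\}$. Suppose that $(x^*,l_f^*,\{l_{g_i}^*\}_{i=1}^m,s_f^*,s_u^*,\{s_{g_i}^*\}_{i=1}^m,\{s_{v_i}^*\}_{i=1}^m)$ is an accumulation point of $\{(x^k,l_f^k,\{l_{g_i}^k\}_{i=1}^m,s_f^k,s_u^k,\{s_{g_i}^k\}_{i=1}^m,\{s_{v_i}^k\}_{i=1}^m)\}$. Then the following statements hold: (i) $\|x^{k+1}-x^k\|\to0$ and $f(x^k)+p(x^k)-u(x^k)\to f(x^* )+p(x^* )-u(x^* )$. (ii) Suppose further that Slater's condition holds for the constraint set $\bar{\mathcal C}(x^*,\{l_{g_i}^*\}_{i=1}^m,\{s_{g_i}^*\}_{i=1}^m,\{s_{v_i}^*\}_{i=1}^m)$, that is, there exists $\bar y\in\mathcal X$ such that $$g_i(x^* )+(s_{g_i}^* )^T(\bar y-x^* )+\tfrac{l_{g_i}^*}2\|\bar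 y-x^*\|^2+q_i(\bar y)-[v_i(x^* )+(s_{v_i}^* )^T(\bar y-x^* )]<0,\quad i=1,\ldots,m.$$ Then $x^*$ is a KKT point of problem (P).
   Context: Setting: $\mathcal X\subseteq\mathbb R^n$ is a nonempty closed convex set and $U$ is an open convex set containing $\mathcal X$. The functions $f,g_1,\ldots,g_m:U\to\mathbb R$ are differentiable at every point of $\mathcal X$. The functions $p,u,q_1,\ldots,q_m,v_1,\ldots,v_m:U\to\mathbb R$ are convex (not necessarily smooth). Standing assumption: there are constants $L_f\ge0$, $L_{g_i}\ge0$ with $\|\nabla f(x)-\nabla f(y)\|\le L_f\|x-y\|$ and $\|\nabla g_i(x)-\nabla g_i(y)\|\le L_{g_i}\|x-y\|$ for all $x,y\in\mathcal X$, $i=1,\ldots,m$. $\|\cdot\|$ is the Euclidean norm, $t^+=\max(t,0)$, $\partial h(x)$ is the convex subdifferential, and $\mathcal N_{\mathcal X}(x)$ is the normal cone of $\mathcal X$ at $x$. The feasible region is $\mathcal F=\{x\in\mathcal X: g_i(x)+q_i(x)-v_i(x)\le0,\ i=1,\ldots,m\}$. KKT point: $x^*\in\mathcal F$ is a KKT point of (P) if there is $\lambda^*\in\mathbb R^m$ with $$0\in\nabla f(x^* )+\partial p(x^* )-\partial u(x^* )+\sum_{i=1}^m\lambda_i^*[\nabla g_i(x^* )+\partial q_i(x^* )-\partial v_i(x^* )]+\mathcal N_{\mathcal X}(x^* ),$$ $\lambda_i^*\ge0$ and $\lambda_i^*[g_i(x^* )+q_i(x^* )-v_i(x^* )]=0$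 for $i=1,\ldots,m$ (Minkowski operations on sets). For $x\in\mathcal F$, $l_f,l_{g_i}\in\mathbb R$ and $s_f,s_u,s_{g_i},s_{v_i}\in\mathbb R^n$, define $$\bar{\mathcal C}(x,\{l_{g_i}\}_{i=1}^m,\{s_{g_i}\}_{i=1}^m,\{s_{v_i}\}_{i=1}^m)=\Big\{y\in\mathcal X:\ g_i(x)+s_{g_i}^T(y-x)+\tfrac{l_{g_i}}2\|y-x\|^2+q_i(y)-[v_i(x)+s_{v_i}^T(y-x)]\le0,\ i=1,\ldots,m\Big\},$$ $$\bar h(y;x,l_f,s_f,s_u)=f(x)+s_f^T(y-x)+\tfrac{l_f}2\|y-x\|^2+p(y)-[u(x)+s_u^T(y-x)],\qquad F(x)=f(x)+p(x)-u(x).$$ Variant of the SCP method: choose parameters $c>0$, $0<L_{\min}<L_{\max}$, $\tau>1$, an integer $M\ge0$, and an arbitrary $x^0\in\mathcal F$; set $k=0$. (1) Set $s_f^k=\nabla f(x^k)$, $s_{g_i}^k=\nabla g_i(x^k)$, and choose any $s_u^k\in\partial u(x^k)$, $s_{v_i}^k\in\partial v_i(x^k)$ for all $i$. (2) Choose $l_f^{k,0},l_{g_i}^{k,0}\in[L_{\min},L_{\max}]$ arbitrarily, and set $l_f^k=l_f^{k,0}$, $l_{g_i}^k=l_{g_i}^{k,0}$ for all $i$. (3) Find $x^{k+1}=\arg\min_y\{\bar h(y;x^k,l_f^k,s_f^k,s_u^k):\ y\in\bar{\mathcal C}(x^k,\{l_{g_i}^k\}_{i=1}^m,\{s_{g_i}^k\}_{i=1}^m,\{s_{v_i}^k\}_{i=1}^m)\}$.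 (3a) If $x^{k+1}\in\mathcal F$ and $$F(x^{k+1})\le\max_{[k-M]^+\le i\le k}F(x^i)-\tfrac c2\|x^{k+1}-x^k\|^2\qquad( * )$$ holds, go to step (4). (3b) If $x^{k+1}\notin\mathcal F$, set $l_{g_i}^k\leftarrow\tau l_{g_i}^k$ for all $i$ and go to step (3). (3c) If $( * )$ does not hold, set $l_f^k\leftarrow\tau l_f^k$ and go to step (3). (4) Set $k\leftarrow k+1$ and go to step (1). The iterate $x^{k+1}$ of the generated sequence is the one accepted in step (3a). *)

(* Defs.v *)
From HB Require Import structures.
From mathcomp Require Import all_boot all_order all_algebra.
From mathcomp Require Import all_classical all_reals all_analysis.

Set Implicit Arguments.
Unset Strict Implicit.
Unset Printing Implicit Defensive.

Import Order.TTheory GRing.Theory Num.Theory.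
Import numFieldNormedType.Exports.

Local Open Scope classical_set_scope.
Local Open Scope ring_scope.

(* Points of R^n are row vectors.  The library norm on ['rV[R]_n] is the sup
   norm, so the Euclidean one is defined here; the topology is the same. *)
Definition dot {R : realType} {n : nat} (a b : 'rV[R]_n) : R :=
  \sum_(j < n) a 0 j * b 0 j.

Definition enorm {R : realType} {n : nat} (a : 'rV[R]_n) : R :=
  Num.sqrt (dot a a).

Definition grad {R : realType} {n : nat} (h : 'rV[R]_n -> R) (x : 'rV[R]_n) :
    'rV[R]_n :=
  \row_(j < n) 'D_(delta_mx 0 j) (h : 'rV[R]_n -> R^o) x.

Definition subdiff {R : realType} {n : nat} (U : set 'rV[R]_n)
    (h : 'rV[R]_n -> R) (x : 'rV[R]_n) : set 'rV[R]_n :=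
  [set s | forall y, U y -> h x + dot s (y - x) <= h y].

Definition normal_cone {R : realType} {n : nat} (X : set 'rV[R]_n)
    (x : 'rV[R]_n) : set 'rV[R]_n :=
  [set z | forall y, X y -> dot z (y - x) <= 0].

Definition argmin {R : realType} {T : Type} (C : set T) (h : T -> R) : set T :=
  [set y | C y /\ forall z, C z -> h y <= h z].

Definition unif_continuous_on {R : realType} {n : nat} (A : set 'rV[R]_n)
    (h : 'rV[R]_n -> R) : Prop :=
  forall e : R, 0 < e -> exists2 d : R, 0 < d &
    forall x y, A x -> A y -> enorm (x - y) < d -> `|h x - h y| < e.

Definition lipschitz_gradient_on {R : realType} {n : nat} (X : set 'rV[R]_n)
    (h : 'rV[R]_n -> R) : Prop :=
  exists2 L : R, 0 <= L & forall x y, X x -> X y ->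
    enorm (grad h x - grad h y) <= L * enorm (x - y).

(* The functions are only meaningful on [U]; they are made total, and every
   notion below depends only on their values on [U]. *)
Record dc_problem (R : realType) (n m : nat) := DCProblem {
  X : set 'rV[R]_n;
  U : set 'rV[R]_n;
  f : 'rV[R]_n -> R;
  p : 'rV[R]_n -> R;
  u : 'rV[R]_n -> R;
  g : 'I_m -> 'rV[R]_n -> R;
  q : 'I_m -> 'rV[R]_n -> R;
  v : 'I_m -> 'rV[R]_n -> R }.

Record standing_assumptions {R : realType} {n m : nat}
    (P : dc_problem R n m) : Prop := StandingAssumptions {
  X_nonempty : X P !=set0;
  X_closed : closed (X P);
  X_convex : convex_set (X P);
  U_open : open (U P);
  U_convex : convex_set (U P);
  X_sub_U : X P `<=` U P;
  f_differentiable : forall x, X P x ->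
    differentiable (f P : 'rV[R]_n -> R^o) x;
  g_differentiable : forall i x, X P x ->
    differentiable (g P i : 'rV[R]_n -> R^o) x;
  p_convex : convex_function (U P) (p P);
  u_convex : convex_function (U P) (u P);
  q_convex : forall i, convex_function (U P) (q P i);
  v_convex : forall i, convex_function (U P) (v P i);
  f_lipschitz : lipschitz_gradient_on (X P) (f P);
  g_lipschitz : forall i, lipschitz_gradient_on (X P) (g P i) }.

Section SCP.
Context {R : realType} {n m : nat} (P : dc_problem R n m).
Implicit Types (x y : 'rV[R]_n) (i : 'I_m).

Definition objective x : R := f P x + p P x - u P x.

Definition constr i x : R := g P i x + q P i x - v P i x.

Definition feasible : set 'rV[R]_n :=
  [set x | X P x /\ forall i, constr i x <= 0].

Definition level_set (x0 : 'rV[R]_n) : set 'rV[R]_n :=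
  [set x | feasible x /\ objective x <= objective x0].

(* Membership of 0 in the Minkowski combination of subdifferentials and normal
   cone, with the elements chosen in each set made explicit; row [i] of [xq]
   (of [xv]) is the element of the subdifferential of [q_i] (of [v_i]). *)
Definition is_KKT x : Prop :=
  feasible x /\
  exists lam : 'rV[R]_m,
    [/\ exists xp xu : 'rV[R]_n, exists xq xv : 'M[R]_(m, n),
        exists z : 'rV[R]_n,
        [/\ subdiff (U P) (p P) x xp,
            subdiff (U P) (u P) x xu,
            forall i, subdiff (U P) (q P i) x (row i xq) /\
                      subdiff (U P) (v P i) x (row i xv),
            normal_cone (X P) x z &
            0 = grad (f P) x + xp - xu
                + \sum_(i < m)
                    lam 0 i *: (grad (g P i) x + row i xq - row i xv)
                + z],
        forall i, 0 <= lam 0 i &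
        forall i, lam 0 i * constr i x = 0].

(* Families of scalars (vectors) indexed by i = 1..m are packed into a row
   vector (into the rows of a matrix). *)
Definition model_constr x (lg : 'rV[R]_m) (sg sv : 'M[R]_(m, n)) i y : R :=
  g P i x + dot (row i sg) (y - x) + lg 0 i / 2 * enorm (y - x) ^+ 2
  + q P i y - (v P i x + dot (row i sv) (y - x)).

Definition model_set x (lg : 'rV[R]_m) (sg sv : 'M[R]_(m, n)) :
    set 'rV[R]_n :=
  [set y | X P y /\ forall i, model_constr x lg sg sv i y <= 0].

Definition model_slater x (lg : 'rV[R]_m) (sg sv : 'M[R]_(m, n)) : Prop :=
  exists2 y, X P y & forall i, model_constr x lg sg sv i y < 0.

Definition model_obj x (lf : R) (sf su : 'rV[R]_n) y : R :=
  f P x + dot sf (y - x) + lf / 2 * enorm (y - x) ^+ 2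
  + p P y - (u P x + dot su (y - x)).

(* The truncated subtraction [k - M] is [k-M]^+; the default value of the
   maximum is the term of index [k], which belongs to the range. *)
Definition nonmonotone_decrease (c : R) (M : nat) (x : nat -> 'rV[R]_n)
    (k : nat) y : Prop :=
  objective y <=
    \big[Num.max/objective (x k)]_((k - M)%N <= i < k.+1) objective (x i)
    - c / 2 * enorm (y - x k) ^+ 2.

(* [scp_inner ... lf lg lf' lg' y]: steps (3)-(3c), entered at step (3) with
   the values [lf], [lg], stop after finitely many passes with final values
   [lf'], [lg'] and accepted point [y]. *)
Inductive scp_inner (c tau : R) (M : nat) (x : nat -> 'rV[R]_n) (k : nat)
    (sf su : 'rV[R]_n) (sg sv : 'M[R]_(m, n)) :
    R -> 'rV[R]_m -> R -> 'rV[R]_m -> 'rV[R]_n -> Prop :=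
| scp_accept lf lg y :
    argmin (model_set (x k) lg sg sv) (model_obj (x k) lf sf su) y ->
    feasible y -> nonmonotone_decrease c M x k y ->
    scp_inner c tau M x k sf su sg sv lf lg lf lg y
| scp_increase_lg lf lg y lf' lg' y' :
    argmin (model_set (x k) lg sg sv) (model_obj (x k) lf sf su) y ->
    ~ feasible y ->
    scp_inner c tau M x k sf su sg sv lf (tau *: lg) lf' lg' y' ->
    scp_inner c tau M x k sf su sg sv lf lg lf' lg' y'
| scp_increase_lf lf lg y lf' lg' y' :
    argmin (model_set (x k) lg sg sv) (model_obj (x k) lf sf su) y ->
    feasible y -> ~ nonmonotone_decrease c M x k y ->
    scp_inner c tau M x k sf su sg sv (tau * lf) lg lf' lg' y' ->
    scp_inner c tau M x k sf su sg sv lf lg lf' lg' y'.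

Record scp_sequence (c Lmin Lmax tau : R) (M : nat)
    (x : nat -> 'rV[R]_n) (lf : nat -> R) (lg : nat -> 'rV[R]_m)
    (sf su : nat -> 'rV[R]_n) (sg sv : nat -> 'M[R]_(m, n)) : Prop :=
  SCPSequence {
  scp_init : feasible (x 0%N);
  scp_sf : forall k, sf k = grad (f P) (x k);
  scp_sg : forall k i, row i (sg k) = grad (g P i) (x k);
  scp_su : forall k, subdiff (U P) (u P) (x k) (su k);
  scp_sv : forall k i, subdiff (U P) (v P i) (x k) (row i (sv k));
  scp_step : forall k, exists lf0 : R, exists lg0 : 'rV[R]_m,
    [/\ Lmin <= lf0 <= Lmax,
        forall i, Lmin <= lg0 0 i <= Lmax &
        scp_inner c tau M x k (sf k) (su k) (sg k) (sv k)
          lf0 lg0 (lf k) (lg k) (x k.+1)] }.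

End SCP.

(* Main.v *)
Require Import Defs.
From mathcomp Require Import all_boot all_order all_algebra.
From mathcomp Require Import all_classical all_reals all_analysis.
From mathcomp Require Import zify ring lra.

(** Part (i) is the classical analysis of nonmonotone line searches.  The
    maximum W_k of the last M + 1 objective values is nonincreasing and bounded
    below by the value at the accumulation point, so it converges, to Wbar say.
    If F(x^(k+1)) is close to Wbar then the acceptance test forces the step
    x^(k+1) - x^k to be short, and uniform continuity then keeps F(x^k) close
    to Wbar as well.  Every window of M + 1 indices contains one where
    F equals the window maximum, hence is at least Wbar; going back at most M
    steps from there shows F(x^k) -> Wbar for the whole sequence
    ([nonmonotone_values_cvg]).  The test then makes all steps vanish
    ([nonmonotone_steps_cvg0]), and Wbar is the value at the accumulation point
    because F is continuous there.

    For part (ii), take indices k_j along which all the data converge.  Since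
    the steps vanish, the accepted points x^(k_j + 1) converge to x* too.  Given
    z in the limit model set and a Slater point w, each point of the open
    segment from z to w is strictly feasible for the limit model, hence feasible
    for the models at x^(k_j) when j is large; comparing model values and then
    letting the point tend to z shows that x* minimizes the limit model
    ([model_argmin_limit]).  That model is a convex program satisfying Slater's
    condition, so it has multipliers ([convex_program_multipliers]).  Its
    quadratic terms are negligible to first order at x*, its linear terms carry
    the gradients and the subgradients of u and v_i at x*, and its optimality
    condition is therefore the KKT condition of the original problem
    ([model_minimizer_is_KKT]).

    The multipliers and the subgradients of all nonsmooth terms come from a
    single separation argument: each nonsmooth function is evaluated at its own
    independently shifted point and each constraint has its own slack, and a
    linear functional supporting the value of the perturbed program at the
    origin has the multipliers and the subgradients as its components
    ([convex_program_perturbation]).  Such a functional exists because every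
    sublinear function on a finite-dimensional space dominates a linear one
    ([sublinear_linear_minorant]).  The remaining ingredient is the continuity
    of convex functions on open sets ([convex_locally_lipschitz]). *)

Set Implicit Arguments.
Unset Strict Implicit.
Unset Printing Implicit Defensive.

Import Order.TTheory GRing.Theory Num.Theory.
Import numFieldNormedType.Exports.

Local Open Scope classical_set_scope.
Local Open Scope ring_scope.

(** * Linear minorants *)

(** Homogeneity is only asked as an inequality, which is easier to establish for
    functions defined as infima; equality follows from it
    ([sublinearZ]). *)
Definition sublinear (R : realType) (V : lmodType R) (S : V -> R) :=
  (forall a d, 0 < a -> S (a *: d) <= a * S d) /\
  (forall d d', S (d + d') <= S d + S d').

Lemma sublinearZ (R : realType) (V : lmodType R) (S : V -> R) a d :
  sublinear S -> 0 < a -> S (a *: d) = a * S d.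
Proof.
move=> [SZ _] a0; apply/eqP; rewrite eq_le SZ //=.
have := SZ a^-1 (a *: d); rewrite invr_gt0 => /(_ a0).
by rewrite scalerA mulVf ?gt_eqF // scale1r ler_pdivlMl.
Qed.

Lemma sublinear0 (R : realType) (V : lmodType R) (S : V -> R) :
  sublinear S -> S 0 = 0.
Proof.
move=> hS; have := sublinearZ 0 hS (ltr0n R 2).
by rewrite scaler0; lra.
Qed.

Lemma sublinear_oppr_ge (R : realType) (V : lmodType R) (S : V -> R) d :
  sublinear S -> - S (- d) <= S d.
Proof.
move=> hS; have := hS.2 d (- d); rewrite subrr sublinear0 //; lra.
Qed.

(** The witness S'(d) = inf_(t >= 0) (S(d + t e) - t S(e)) is finite because
    t S(e) <= S(d + t e) + S(- d).  Taking t = 0 gives S' <= S, and t = 1 at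
    d = - e makes S' linear on the line spanned by e. *)
Lemma sublinear_linearize (R : realType) (V : lmodType R) (S : V -> R) (e : V) :
  sublinear S ->
  exists S' : V -> R,
    [/\ sublinear S', forall d, S' d <= S d & S' (- e) <= - S' e].
Proof.
move=> hS.
pose A d := [set S (d + t *: e) - t * S e | t in [set t : R | 0 <= t]].
have SZ0 t d : 0 <= t -> S (t *: d) = t * S d.
  rewrite le_eqVlt => /predU1P[<-|]; last exact: sublinearZ.
  by rewrite scale0r sublinear0 // mul0r.
have lbA d : lbound (A d) (- S (- d)).
  move=> _ [t /= t0 <-].
  have := hS.2 (d + t *: e) (- d); rewrite addrC addKr SZ0 //; lra.
have inA d t : 0 <= t -> inf (A d) <= S (d + t *: e) - t * S e.
  by move=> t0; apply: ge_inf; [exists (- S (- d)); exact: lbA | exists t].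
have neA d : A d !=set0 by exists (S (d + 0 *: e) - 0 * S e); exists 0 => //=.
exists (fun d => inf (A d)); split.
- split=> [a d a0|d d'].
    rewrite mulrC -ler_pdivrMr //; apply: lb_le_inf => // _ [t /= t0 <-].
    rewrite ler_pdivrMr // mulrC.
    apply: le_trans (inA _ (a * t) _) _; first by rewrite mulr_ge0 // ltW.
    by rewrite -scalerA -scalerDr sublinearZ // -mulrA mulrBr.
  rewrite -lerBlDr; apply: lb_le_inf => // _ [t /= t0 <-].
  rewrite lerBlDr [leRHS]addrC -lerBlDr.
  apply: lb_le_inf => // _ [t' /= t0' <-].
  rewrite lerBlDr; apply: le_trans (inA _ (t + t') _) _; first exact: addr_ge0.
  have := hS.2 (d + t *: e) (d' + t' *: e).
  rewrite addrACA -scalerDl; lra.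
- by move=> d; have := inA d 0 (lexx _); rewrite scale0r addr0 mul0r subr0.
- have := inA (- e) 1 ler01; rewrite scale1r addNr sublinear0 //.
  by have := inA e 0 (lexx _); rewrite scale0r addr0; lra.
Qed.

(** Hahn-Banach in finite dimension: [sublinear_linearize] is applied
    to each vector of a basis in turn.  Linearity along the earlier vectors
    survives, since decreasing S preserves S(- b) <= - S(b).  The linear
    function with the final values on the basis then dominates the final
    sublinear function, hence by oddness is also below it. *)
Lemma sublinear_linear_minorant (R : realType) (V : vectType R) (S : V -> R) :
  sublinear S ->
  exists2 l : V -> R, scalar l & forall d, l d <= S d.
Proof.
move=> hS.
have lin (bs : seq V) : exists S' : V -> R,
    [/\ sublinear S', forall d, S' d <= S d
      & forall b, b \in bs -> S' (- b) <= - S' b].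
  elim: bs => [|e bs [S1 [hS1 S1S S1bs]]]; first by exists S.
  have [S2 [hS2 S2S1 S2e]] := sublinear_linearize e hS1.
  exists S2; split=> //; first by move=> d; exact: le_trans (S1S d).
  move=> b; rewrite inE => /predU1P[-> //|/S1bs S1b].
  apply: (le_trans (S2S1 _)); apply: (le_trans S1b).
  by rewrite lerN2.
pose B := vbasis {: V}.
have [S' [hS' S'S S'B]] := lin B.
pose l (d : V) : R := \sum_i coord B i d * S' B`_i.
have l_lin : scalar l.
  move=> a d d'; rewrite /l mulr_sumr -big_split /=; apply: eq_bigr => i _.
  by rewrite linearP /= mulrDl mulrA.
have S'l d : S' d <= l d.
  rewrite [in S' d](coord_vbasis (memvf d)) /l.
  apply: (big_ind2 (fun (v : V) r => S' v <= r)).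
  - by rewrite sublinear0.
  - move=> v r w r' hv hw; apply: (le_trans (hS'.2 _ _)); exact: lerD.
  - move=> i _; set a := coord B i d.
    have [a0|a0|->] := ltgtP a 0; first last.
    + by rewrite scale0r mul0r sublinear0.
    + exact: hS'.1.
    + have na0 : 0 < - a by rewrite oppr_gt0.
      have -> : a *: B`_i = (- a) *: (- B`_i) by rewrite scalerN scaleNr opprK.
      rewrite (sublinearZ _ hS' na0) -[leRHS]mulrNN ler_pM2l //.
      by apply: S'B; rewrite mem_nth ?size_tuple.
exists l => // d; apply: le_trans (S'S d).
apply: le_trans (sublinear_oppr_ge d hS'); rewrite lerNr.
apply: (le_trans (S'l _)).
have l0 : l 0 = 0 by have := l_lin 1 0 0; rewrite scaler0 addr0; lra.
by have := l_lin (-1) d 0; rewrite scaleN1r addr0 l0; lra.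
Qed.

(** [K d r] is to be read as membership of (d, r) in the epigraph of a convex
    function of the perturbation d which is nonnegative at 0.  Its directional
    derivative at 0, here the infimum of r / t over K (t d) r, is sublinear; it
    is finite since a segment joining points of the epigraph above t d and
    - t' d passes above 0. *)
Lemma convex_relation_linear_minorant (R : realType) (V : vectType R)
    (K : V -> R -> Prop) :
  (forall d r d' r' t, K d r -> K d' r' -> 0 <= t <= 1 ->
     K (t *: d + (1 - t) *: d') (t * r + (1 - t) * r')) ->
  (forall d, exists t r, 0 < t /\ K (t *: d) r) ->
  (forall r, K 0 r -> 0 <= r) ->
  exists2 l : V -> R, scalar l & forall d r, K d r -> l d <= r.
Proof.
move=> Kcvx Kabs K0.
pose A d := [set rt.1 / rt.2 | rt in
  [set rt : R * R | 0 < rt.2 /\ K (rt.2 *: d) rt.1]].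
(* the weights that make both perturbations have length t t' / (t + t') *)
have comb d r t d' r' t' : 0 < t -> 0 < t' -> K (t *: d) r -> K (t' *: d') r' ->
    K ((t * t' / (t + t')) *: (d + d')) ((t' * r + t * r') / (t + t')).
  move=> t0 t0' Kd Kd'.
  have tt0 : 0 < t + t' by rewrite addr_gt0.
  have w01 : 0 <= t' / (t + t') <= 1.
    by rewrite ler_pdivrMr // mul1r ler_pdivlMr // mul0r; lra.
  have := Kcvx _ _ _ _ _ Kd Kd' w01.
  have -> : 1 - t' / (t + t') = t / (t + t') by field; rewrite gt_eqF.
  rewrite !scalerA scalerDr.
  have -> : t' / (t + t') * t = t * t' / (t + t') by ring.
  have -> : t / (t + t') * t' = t * t' / (t + t') by ring.
  by have -> : t' / (t + t') * r + t / (t + t') * r' =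
    (t' * r + t * r') / (t + t') by ring.
have neA d : A d !=set0.
  by have [t [r [t0 Kd]]] := Kabs d; exists (r / t); exists (r, t).
have lbA d : has_lbound (A d).
  have [t' [r' [t0' Kd']]] := Kabs (- d).
  exists (- (r' / t')) => _ [[r t] /= [t0 Kd] <-].
  have := comb _ _ _ _ _ _ t0 t0' Kd Kd'; rewrite subrr scaler0 => /K0.
  have tt0 : 0 < t + t' by rewrite addr_gt0.
  rewrite pmulr_lge0 ?invr_gt0 // => h.
  rewrite -subr_ge0 opprK.
  have -> : r / t + r' / t' = (t' * r + t * r') / (t * t').
    by field; rewrite !gt_eqF.
  by rewrite divr_ge0 // mulr_ge0 // ltW.
pose S d := inf (A d).
have inA d r t : 0 < t -> K (t *: d) r -> S d <= r / t.
  by move=> t0 Kd; apply: ge_inf => //; exists (r, t).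
have hS : sublinear S.
  split=> [a d a0|d d'].
    rewrite mulrC -ler_pdivrMr //; apply: lb_le_inf => // _ [[r t] /= [t0 Kd] <-].
    rewrite ler_pdivrMr //.
    have -> : r / t * a = r / (t / a) by field; rewrite !gt_eqF.
    apply: inA; first exact: divr_gt0.
    by rewrite scalerA divfK ?gt_eqF.
  rewrite -lerBlDr; apply: lb_le_inf => // _ [[r t] /= [t0 Kd] <-].
  rewrite lerBlDr [leRHS]addrC -lerBlDr.
  apply: lb_le_inf => // _ [[r' t'] /= [t0' Kd'] <-]; rewrite lerBlDr.
  have tt0 : 0 < t + t' by rewrite addr_gt0.
  apply: (le_trans (inA _ _ _ _ (comb _ _ _ _ _ _ t0 t0' Kd Kd'))).
    by rewrite divr_gt0 // mulr_gt0.
  rewrite le_eqVlt; apply/orP; left; apply/eqP; field.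
  by rewrite !gt_eqF.
have [l l_lin lS] := sublinear_linear_minorant hS.
exists l => // d r Kd; apply: (le_trans (lS d)).
have := @inA d r 1 ltr01; rewrite scale1r divr1; exact.
Qed.

(** * Convex functions on open convex sets *)

Lemma convex_setP (R : realType) (V : lmodType R) (A : set V) x y (t : R) :
  convex_set A -> A x -> A y -> 0 <= t <= 1 -> A (t *: x + (1 - t) *: y).
Proof.
move=> cA Ax Ay /andP[t0 t1].
by have := cA x y (Itv01 t0 t1) (mem_set Ax) (mem_set Ay); rewrite inE.
Qed.

Lemma convex_functionP (R : realType) (V : lmodType R) (A : set V)
    (h : V -> R) :
  convex_function A h <->
  forall x y t, A x -> A y -> 0 <= t <= 1 ->
    h (t *: x + (1 - t) *: y) <= t * h x + (1 - t) * h y.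
Proof.
split=> [ch x y t Ax Ay /andP[t0 t1]|ch t x y /set_mem Ax /set_mem Ay].
  exact: ch (Itv01 t0 t1) x y (mem_set Ax) (mem_set Ay).
by apply: ch => //; rewrite ge0 le1.
Qed.

Lemma combD (R : realType) (V : lmodType R) (x y d d' : V) (t : R) :
  t *: (x + d) + (1 - t) *: (y + d') =
  (t *: x + (1 - t) *: y) + (t *: d + (1 - t) *: d').
Proof. by rewrite !scalerDr addrACA. Qed.

Lemma combxx (R : realType) (V : lmodType R) (x : V) (t : R) :
  t *: x + (1 - t) *: x = x.
Proof. by rewrite -scalerDl [t + _]addrC subrK scale1r. Qed.

Lemma cvg_segment (R : realType) (V : normedModType R) (x d : V) :
  x + t *: d @[t --> (0 : R)] --> x.
Proof.
rewrite -[X in _ --> X]addr0 -[X in _ --> x + X](scale0r d).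
by apply: cvgD; [exact: cvg_cst | apply: cvgZr_tmp; exact: cvg_id].
Qed.

Lemma open_segment (R : realType) (V : normedModType R) (U : set V) (x d : V) :
  open U -> U x -> \forall t \near (0 : R), U (x + t *: d).
Proof.
by move=> oU Ux; exact: cvg_segment (open_nbhs_nbhs (conj oU Ux)).
Qed.

(** Points between x and x + s d, with s = delta or s = - delta, are convex
    combinations of x and that fixed end point, with weight proportional to
    their distance from x. *)
Lemma convex_segment_upper_bound (R : realType) (V : normedModType R)
    (U : set V) (h : V -> R) (x d : V) :
  open U -> convex_set U -> convex_function U h -> U x ->
  exists delta C : R, [/\ 0 < delta, 0 <= C &
    forall t, `|t| <= delta ->
      U (x + t *: d) /\ h (x + t *: d) <= h x + C * `|t|].
Proof.
move=> oU cU /convex_functionP ch Ux.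
have /nbhs_ballP[e /= e0 eU] := open_segment d oU Ux.
pose a := e / 2.
have a0 : 0 < a by rewrite divr_gt0.
have aU t : `|t| <= a -> U (x + t *: d).
  move=> ta; apply: eU; rewrite -ball_normE /= sub0r normrN.
  by apply: le_lt_trans ta _; rewrite /a; lra.
(* one constant for both end points, so that the sign of t is irrelevant *)
pose B := `|h (x + a *: d) - h x| + `|h (x - a *: d) - h x|.
exists a, (B / a); split=> //; first by rewrite divr_ge0 ?addr_ge0 // ltW.
move=> t ta; split; first exact: aU.
have seg (s : R) : `|s| = a -> h (x + s *: d) - h x <= B ->
    t / s = `|t| / a -> h (x + t *: d) <= h x + B / a * `|t|.
  move=> sa hB ts.
  have s0 : s != 0 by rewrite -normr_gt0 sa.
  have w01 : 0 <= `|t| / a <= 1.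
    by rewrite ler_pdivrMr // mul1r ta andbT divr_ge0 // ltW.
  have := ch _ _ _ (aU s _) Ux w01; rewrite sa lexx => /(_ isT).
  have -> : (`|t| / a) *: (x + s *: d) + (1 - `|t| / a) *: x = x + t *: d.
    by rewrite scalerDr addrAC combxx scalerA -ts divfK.
  move=> /le_trans; apply.
  have -> : `|t| / a * h (x + s *: d) + (1 - `|t| / a) * h x =
    h x + (h (x + s *: d) - h x) * (`|t| / a) by ring.
  have -> : B / a * `|t| = B * (`|t| / a) by ring.
  by rewrite lerD2l ler_wpM2r //; case/andP: w01.
have [t0|t0] := leP 0 t.
  apply: (seg a).
  - by rewrite gtr0_norm.
  - by apply: (le_trans (ler_norm _)); rewrite lerDl.
  - by rewrite ger0_norm.
apply: (seg (- a)).
- by rewrite normrN gtr0_norm.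
- by rewrite scaleNr; apply: (le_trans (ler_norm _)); rewrite lerDr.
- by rewrite ltr0_norm // invrN mulrN mulNr.
Qed.

(** A combination of several directions is the midpoint of a point moved along
    the first direction only and one moved along the others only, both twice as
    far; hence the induction, which halves delta at each step. *)
Lemma convex_span_upper_bound (R : realType) (V : normedModType R)
    (U : set V) (h : V -> R) (x : V) (I : Type) (s : seq I) (d : I -> V) :
  open U -> convex_set U -> convex_function U h -> U x ->
  exists delta C : R, [/\ 0 < delta, 0 <= C &
    forall r (c : I -> R), r <= delta -> (forall i, `|c i| <= r) ->
      let y := x + \sum_(i <- s) c i *: d i in U y /\ h y <= h x + C * r].
Proof.
move=> oU cU ch Ux; elim: s => [|j s [del [C [del0 C0 IH]]]].
  exists 1, 0; split=> // r c _ _; rewrite big_nil addr0 mul0r addr0.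
  by split.
have [del' [C' [del0' C0' Hj]]] := convex_segment_upper_bound (d j) oU cU ch Ux.
exists (Num.min del del' / 2), (C + C'); split.
- by rewrite divr_gt0 // lt_min del0 del0'.
- exact: addr_ge0.
move=> r c; rewrite ler_pdivlMr // le_min => /andP[rd rd'] cr /=.
have c2 i : `|2 * c i| <= r * 2.
  by rewrite normrM ger0_norm // mulrC ler_pM2r.
have [Uy hy] := IH _ (fun i => 2 * c i) rd c2.
have [Uz hz] := Hj (2 * c j) (le_trans (c2 j) rd').
have half01 : 0 <= (2^-1 : R) <= 1 by lra.
rewrite big_cons.
have -> : x + (c j *: d j + \sum_(i <- s) c i *: d i) =
    2^-1 *: (x + (2 * c j) *: d j) +
    (1 - 2^-1) *: (x + \sum_(i <- s) (2 * c i) *: d i).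
  have -> : 1 - 2^-1 = 2^-1 :> R by lra.
  rewrite -scalerDr addrACA scalerDr -[x + x]mulr2n -[x *+ 2]scaler_nat.
  rewrite scalerA mulVf // scale1r scalerDr scaler_sumr scalerA.
  rewrite mulrA mulVf // mul1r; congr (_ + (_ + _)).
  by apply: eq_bigr => i _; rewrite scalerA mulrA mulVf // mul1r.
split; first exact: convex_setP.
move/convex_functionP: ch => ch.
apply: (le_trans (ch _ _ _ Uz Uy half01)).
have : C' * `|2 * c j| <= C' * (r * 2) by rewrite ler_wpM2l.
move: hy hz; lra.
Qed.

Lemma coord_le_norm (R : realType) m n (a : 'M[R]_(m, n)) i j :
  `|a i j| <= `|a|.
Proof.
by rewrite [leRHS]mx_normrE (le_bigmax _ (fun ij => `|a ij.1 ij.2|) (i, j)).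
Qed.

(** The upper bound comes from the coordinate directions; the lower bound is the
    upper bound at the reflected point 2 x - y, since x is the midpoint of y
    and 2 x - y. *)
Lemma convex_locally_lipschitz (R : realType) n (U : set 'rV[R]_n)
    (h : 'rV[R]_n -> R) (x : 'rV[R]_n) :
  open U -> convex_set U -> convex_function U h -> U x ->
  exists delta C : R, [/\ 0 < delta, 0 <= C &
    forall y, `|y - x| <= delta -> `|h y - h x| <= C * `|y - x| ].
Proof.
move=> oU cU ch Ux.
have [del [C [del0 C0 H]]] :=
  convex_span_upper_bound (enum 'I_n) (fun j => delta_mx 0 j) oU cU ch Ux.
have up w : `|w| <= del -> U (x + w) /\ h (x + w) <= h x + C * `|w|.
  move=> wd; have := H `|w| (fun j => w 0 j) wd (fun j => coord_le_norm w 0 j).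
  by rewrite /= big_enum /= -row_sum_delta.
exists del, C; split=> // y yd.
have [Uy hy] := up (y - x) yd.
have [Uz hz] := up (- (y - x)) (eq_ind_r (fun a => a <= del) yd (normrN _)).
move: hz hy Uy Uz; rewrite normrN subrKC => hz hy Uy Uz.
have half01 : 0 <= (2^-1 : R) <= 1 by lra.
move/convex_functionP: ch => /(_ _ _ _ Uy Uz half01).
have half : 1 - 2^-1 = 2^-1 :> R by lra.
have -> : 2^-1 *: y + (1 - 2^-1) *: (x - (y - x)) = x.
  rewrite half -scalerDr opprB addrCA subrKC -mulr2n.
  by rewrite -[x *+ 2]scaler_nat scalerA mulVf // scale1r.
rewrite half => hx.
by rewrite ler_norml; apply/andP; split; lra.
Qed.

Lemma convex_continuous (R : realType) n (U : set 'rV[R]_n)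
    (h : 'rV[R]_n -> R) (x : 'rV[R]_n) :
  open U -> convex_set U -> convex_function U h -> U x ->
  h y @[y --> x] --> h x.
Proof.
move=> oU cU ch Ux.
have [del [C [del0 C0 H]]] := convex_locally_lipschitz oU cU ch Ux.
apply/(@cvgrPdist_le R R^o _ (nbhs x) (nbhs_filter x) h (h x)) => e e0.
apply/nbhs_ballP.
have C1 : 0 < C + 1 by lra.
exists (Num.min del ((C + 1)^-1 * e)) => /=.
  by rewrite lt_min del0 mulr_gt0 // invr_gt0.
move=> y; rewrite -ball_normE /= distrC lt_min => /andP[yd ye].
rewrite distrC; apply: (le_trans (H y (ltW yd))).
apply: (@le_trans _ _ ((C + 1) * `|y - x|)); first by rewrite ler_wpM2r // lerDl.
by rewrite -ler_pdivlMl // ltW.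
Qed.

Lemma scalar0 (R : realType) (V : lmodType R) (l : V -> R) :
  scalar l -> l 0 = 0.
Proof. by move=> l_lin; have := l_lin 1 0 0; rewrite scaler0 addr0; lra. Qed.

Lemma scalar_mx_dot (R : realType) k n (l : 'M[R]_(k, n) -> R) :
  scalar l ->
  exists S : 'M[R]_(k, n), forall W, l W = \sum_i dot (row i S) (row i W).
Proof.
move=> l_lin; exists (\matrix_(i, j) l (delta_mx i j)) => W.
have lD a b : l (a + b) = l a + l b.
  by have := l_lin 1 a b; rewrite scale1r mul1r.
have lZ c a : l (c *: a) = c * l a.
  by have := l_lin c a 0; rewrite addr0 scalar0 // addr0.
rewrite {1}(matrix_sum_delta W) (big_morph l lD (scalar0 l_lin)).
apply: eq_bigr => i _; rewrite (big_morph l lD (scalar0 l_lin)).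
by apply: eq_bigr => j _; rewrite lZ !mxE mulrC.
Qed.

Lemma scalar_rV_dot (R : realType) n (l : 'rV[R]_n -> R) :
  scalar l -> exists s : 'rV[R]_n, forall w, l w = dot s w.
Proof.
move=> /scalar_mx_dot[S lS]; exists (row 0 S) => w.
by rewrite lS big_ord1; congr dot; apply/rowP => j; rewrite mxE.
Qed.

(** The linear minorant of the increments of h from x. *)
Lemma convex_subgradient (R : realType) n (U : set 'rV[R]_n)
    (h : 'rV[R]_n -> R) (x : 'rV[R]_n) :
  open U -> convex_set U -> convex_function U h -> U x ->
  subdiff U h x !=set0.
Proof.
move=> oU cU /convex_functionP ch Ux.
have [|||l l_lin lK] := @convex_relation_linear_minorant R 'rV[R]_n
  (fun d r => U (x + d) /\ h (x + d) - h x <= r).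
- move=> d r d' r' t [Ud hd] [Ud' hd'] t01.
  have -> : x + (t *: d + (1 - t) *: d') =
      t *: (x + d) + (1 - t) *: (x + d').
    by rewrite combD combxx.
  split; first exact: convex_setP.
  have := ch _ _ _ Ud Ud' t01; case/andP: t01 => t0 t1.
  have : t * (h (x + d) - h x) <= t * r by rewrite ler_wpM2l.
  have : (1 - t) * (h (x + d') - h x) <= (1 - t) * r'.
    by rewrite ler_wpM2l // subr_ge0.
  lra.
- move=> d; have /nbhs_ballP[e /= e0 eU] := open_segment d oU Ux.
  exists (e / 2), (h (x + (e / 2) *: d) - h x); split; first exact: divr_gt0.
  split=> //; apply: eU; rewrite -ball_normE /= sub0r normrN.
  by rewrite gtr0_norm ?divr_gt0 //; lra.
- by move=> r; rewrite addr0 subrr => -[].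
have [s ls] := scalar_rV_dot l_lin.
exists s => y Uy; rewrite -ls.
have := lK (y - x) (h y - h x); rewrite subrKC => /(_ (conj Uy (lexx _))).
lra.
Qed.

(** * Multipliers and subgradients for a convex program *)

Lemma dotC (R : realType) n (a b : 'rV[R]_n) : dot a b = dot b a.
Proof. by apply: eq_bigr => j _; rewrite mulrC. Qed.

Lemma dotDr (R : realType) n (a b c : 'rV[R]_n) :
  dot a (b + c) = dot a b + dot a c.
Proof. by rewrite -big_split /=; apply: eq_bigr => j _; rewrite mxE mulrDr. Qed.

Lemma dotZr (R : realType) n (a b : 'rV[R]_n) t : dot a (t *: b) = t * dot a b.
Proof. by rewrite mulr_sumr; apply: eq_bigr => j _; rewrite mxE mulrCA. Qed.

Lemma dotNr (R : realType) n (a b : 'rV[R]_n) : dot a (- b) = - dot a b.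
Proof. by rewrite -scaleN1r dotZr mulN1r. Qed.

Lemma dotDl (R : realType) n (a b c : 'rV[R]_n) :
  dot (a + b) c = dot a c + dot b c.
Proof. by rewrite dotC dotDr !(dotC c). Qed.

Lemma dotZl (R : realType) n (a b : 'rV[R]_n) t : dot (t *: a) b = t * dot a b.
Proof. by rewrite dotC dotZr dotC. Qed.

Lemma dotNl (R : realType) n (a b : 'rV[R]_n) : dot (- a) b = - dot a b.
Proof. by rewrite dotC dotNr dotC. Qed.

Lemma dot0r (R : realType) n (a : 'rV[R]_n) : dot a 0 = 0.
Proof. by rewrite -(scale0r 0) dotZr mul0r. Qed.

Lemma dot0l (R : realType) n (a : 'rV[R]_n) : dot 0 a = 0.
Proof. by rewrite dotC dot0r. Qed.

Lemma dot_suml (R : realType) n (I : finType) (a : I -> 'rV[R]_n) b :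
  dot (\sum_i a i) b = \sum_i dot (a i) b.
Proof.
by rewrite (big_morph (dot^~ b) (fun x y => dotDl x y b) (dot0l b)).
Qed.

Lemma dot_ge0 (R : realType) n (a : 'rV[R]_n) : 0 <= dot a a.
Proof. by apply: sumr_ge0 => j _; rewrite -expr2 sqr_ge0. Qed.

Lemma dot_eq0 (R : realType) n (a : 'rV[R]_n) : dot a a <= 0 -> a = 0.
Proof.
move=> a0; have /eqP : dot a a = 0 by apply/eqP; rewrite eq_le a0 dot_ge0.
rewrite psumr_eq0 => [/allP h|j _]; last by rewrite -expr2 sqr_ge0.
apply/rowP => j; rewrite mxE; apply/eqP.
by have := h j (mem_index_enum j); rewrite /= mulf_eq0 orbb.
Qed.

(** Moving from x a little in the direction T itself would make the scalar
    product positive. *)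
Lemma open_normal_eq0 (R : realType) n (U : set 'rV[R]_n) (x T : 'rV[R]_n) :
  open U -> U x -> (forall z, U z -> dot T (z - x) <= 0) -> T = 0.
Proof.
move=> oU Ux h; apply: dot_eq0.
have /nbhs_ballP[e /= e0 eU] := open_segment T oU Ux.
have : U (x + (e / 2) *: T).
  apply: eU; rewrite -ball_normE /= sub0r normrN gtr0_norm ?divr_gt0 //; lra.
move=> /h; rewrite addrC addKr dotZr pmulr_rle0 // divr_gt0 //.
Qed.

(** This is the inclusion of the subdifferential of lam h in lam times that of
    h.  When lam = 0 the vector T vanishes and s may be any subgradient, so
    that one has to exist. *)
Lemma subdiff_scale_inv (R : realType) n (U : set 'rV[R]_n) (h : 'rV[R]_n -> R)
    (x T : 'rV[R]_n) lam :
  open U -> convex_set U -> convex_function U h -> U x -> 0 <= lam ->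
  (forall z, U z -> dot T (z - x) <= lam * (h z - h x)) ->
  exists s, subdiff U h x s /\ T = lam *: s.
Proof.
move=> oU cU ch Ux lam0 hT.
have [l0|l_neq0] := eqVneq lam 0.
  have [s hs] := convex_subgradient oU cU ch Ux.
  exists s; split=> //; rewrite l0 scale0r.
  apply: (open_normal_eq0 oU Ux) => z Uz.
  by have := hT z Uz; rewrite l0 mul0r.
have l_gt0 : 0 < lam by rewrite lt_def l_neq0.
exists (lam^-1 *: T); split; last by rewrite scalerA mulfV // scale1r.
move=> z Uz; rewrite dotZl.
have : lam^-1 * dot T (z - x) <= h z - h x by rewrite ler_pdivrMl // hT.
lra.
Qed.

(** In the perturbed program, w shifts the argument of p, row i of W that of
    q_i, and b_i is the slack of constraint i.  Near the Slater point every
    small perturbation is feasible, which is what makes the value of the program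
    finite in all directions. *)
Lemma convex_program_perturbation (R : realType) n m (X U : set 'rV[R]_n)
    (a0 p : 'rV[R]_n -> R) (a q : 'I_m -> 'rV[R]_n -> R) (xs : 'rV[R]_n) :
  open U -> convex_set U -> convex_set X -> X `<=` U ->
  convex_function X a0 -> (forall i, convex_function X (a i)) ->
  convex_function U p -> (forall i, convex_function U (q i)) ->
  (forall y, X y -> (forall i, a i y + q i y <= 0) ->
     a0 xs + p xs <= a0 y + p y) ->
  (exists2 y, X y & forall i, a i y + q i y < 0) ->
  exists (s : 'rV[R]_n) (mu : 'rV[R]_m) (T : 'M[R]_(m, n)),
    forall (y w : 'rV[R]_n) (b : 'rV[R]_m) (W : 'M[R]_(m, n)),
      X y -> U (y + w) -> (forall i, U (y + row i W)) ->
      (forall i, a i y + q i (y + row i W) <= b 0 i) ->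
      dot s w + dot mu b + \sum_i dot (row i T) (row i W) <=
      a0 y + p (y + w) - (a0 xs + p xs).
Proof.
move=> oU cU cX XU /convex_functionP ca0 ca /convex_functionP cp cq xs_min.
move=> [ys Xys ys_lt].
pose K (d : 'rV[R]_n * 'rV[R]_m * 'M[R]_(m, n)) (r : R) := exists y,
  [/\ X y, U (y + d.1.1), forall i, U (y + row i d.2),
      forall i, a i y + q i (y + row i d.2) <= d.1.2 0 i
    & a0 y + p (y + d.1.1) - (a0 xs + p xs) <= r].
have [|||l l_lin lK] := @convex_relation_linear_minorant R _ K.
- move=> d r d' r' t [y [Xy Uw UW yb yr]] [y' [Xy' Uw' UW' yb' yr']] t01.
  have /andP[t0 t1] := t01; have {}t1 : 0 <= 1 - t by rewrite subr_ge0.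
  have mono (u v u' v' : R) : u <= v -> u' <= v' ->
      t * u + (1 - t) * u' <= t * v + (1 - t) * v'.
    by move=> uv uv'; rewrite lerD // ler_wpM2l.
  have rowE i : row i (t *: d.2 + (1 - t) *: d'.2) =
    t *: row i d.2 + (1 - t) *: row i d'.2 by rewrite !linearD !linearZ.
  exists (t *: y + (1 - t) *: y'); split.
  + exact: convex_setP.
  + by rewrite -combD; exact: convex_setP.
  + by move=> i; rewrite rowE -combD; exact: convex_setP.
  + move=> i; rewrite rowE -combD !mxE.
    apply: le_trans (mono _ _ _ _ (yb i) (yb' i)).
    rewrite !mulrDr addrACA; apply: lerD.
      by move/convex_functionP: (ca i); apply.
    by move/convex_functionP: (cq i); apply.
  + rewrite -combD; apply: le_trans (mono _ _ _ _ yr yr').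
    have := ca0 _ _ _ Xy Xy' t01; have := cp _ _ _ Uw Uw' t01; lra.
- move=> [[w b] W].
  have near_w := open_segment w oU (XU _ Xys).
  have near_W : \forall t \near (0 : R), forall i, U (ys + t *: row i W).
    apply: (@filter_forall _ _ (fun i t => U (ys + t *: row i W)) (nbhs (0 : R))).
    by move=> i; apply: open_segment => //; exact: XU.
  have near_b : \forall t \near (0 : R), forall i,
      a i ys + q i (ys + t *: row i W) - t * b 0 i < 0.
    apply: (@filter_forall _ _ (fun i t =>
      a i ys + q i (ys + t *: row i W) - t * b 0 i < 0) (nbhs (0 : R))) => i.
    have lim : a i ys + q i (ys + t *: row i W) - t * b 0 i @[t --> (0 : R)]
        --> a i ys + q i ys - 0 * b 0 i.
      apply: cvgB; last by apply: cvgMl; exact: cvg_id.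
      apply: cvgD; first exact: cvg_cst.
      apply: (@cvg_comp _ _ _ (fun t : R => ys + t *: row i W) (q i)
        (nbhs (0 : R)) (nbhs ys)); last first.
        by apply: (convex_continuous oU cU (cq i)); exact: XU.
      exact: cvg_segment.
    by apply: (cvgr_lt _ lim); rewrite mul0r subr0.
  have [e /= e0 eU] : nbhs_ball (0 : R) [set t | [/\ U (ys + t *: w),
      forall i, U (ys + t *: row i W) &
      forall i, a i ys + q i (ys + t *: row i W) - t * b 0 i < 0]].
    apply/nbhs_ballP; near=> t; split; by near: t.
  have [] := eU (e / 2).
    by rewrite -ball_normE /= sub0r normrN gtr0_norm ?divr_gt0 //; lra.
  move=> Uw UW hb.
  exists (e / 2), (a0 ys + p (ys + (e / 2) *: w) - (a0 xs + p xs)).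
  split; first exact: divr_gt0.
  have rowZ i : row i ((e / 2) *: W) = (e / 2) *: row i W by rewrite linearZ.
  exists ys; split=> //= i; rewrite rowZ //.
  by rewrite [leRHS]mxE; have := hb i; lra.
- move=> r [y [Xy Uw UW yb yr]]; apply: le_trans yr.
  rewrite subr_ge0 /= addr0; apply: xs_min => // i.
  by have := yb i; rewrite /= linear0 addr0 mxE.
have l_split w b W : l (w, b, W) = l (w, 0, 0) + l (0, b, 0) + l (0, 0, W).
  have lD u v : l (u + v) = l u + l v.
    by have := l_lin 1 u v; rewrite scale1r mul1r.
  rewrite -!lD; apply: (congr1 l).
  by congr (_, _, _); rewrite /= !(addr0, add0r).
have [s sE] : exists s : 'rV[R]_n, forall w, l (w, 0, 0) = dot s w.
  apply: scalar_rV_dot => c u v; rewrite -l_lin; apply: (congr1 l).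
  by congr (_, _, _); rewrite /= scaler0 addr0.
have [mu muE] : exists s : 'rV[R]_m, forall w, l (0, w, 0) = dot s w.
  apply: scalar_rV_dot => c u v; rewrite -l_lin; apply: (congr1 l).
  by congr (_, _, _); rewrite /= scaler0 addr0.
have [T TE] : exists T : 'M[R]_(m, n),
    forall W, l (0, 0, W) = \sum_i dot (row i T) (row i W).
  apply: scalar_mx_dot => c u v; rewrite -l_lin; apply: (congr1 l).
  by congr (_, _, _); rewrite /= scaler0 addr0.
exists s, mu, T => y w b W Xy Uw UW hb.
rewrite -sE -muE -TE -l_split; apply: lK.
by exists y; split.
Unshelve. all: by end_near.
Qed.

(** Everything is read off the supporting functional (s, mu, T) of
    [convex_program_perturbation] by choosing perturbations: at y = xs,
    increasing one slack gives the sign of mu, and the slack equal to the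
    constraint value gives complementarity; shifting one argument from xs to z
    gives a subgradient inequality; and shifting all arguments from y back to
    xs gives the final inequality, where the nonsmooth functions only occur
    through their values at xs. *)
Lemma convex_program_multipliers (R : realType) n m (X U : set 'rV[R]_n)
    (a0 p : 'rV[R]_n -> R) (a q : 'I_m -> 'rV[R]_n -> R) (xs : 'rV[R]_n) :
  open U -> convex_set U -> convex_set X -> X `<=` U ->
  convex_function X a0 -> (forall i, convex_function X (a i)) ->
  convex_function U p -> (forall i, convex_function U (q i)) ->
  X xs -> (forall i, a i xs + q i xs <= 0) ->
  (forall y, X y -> (forall i, a i y + q i y <= 0) ->
     a0 xs + p xs <= a0 y + p y) ->
  (exists2 y, X y & forall i, a i y + q i y < 0) ->
  exists (lam : 'rV[R]_m) (xp : 'rV[R]_n) (xq : 'M[R]_(m, n)),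
    [/\ forall i, 0 <= lam 0 i,
        forall i, lam 0 i * (a i xs + q i xs) = 0,
        subdiff U p xs xp,
        forall i, subdiff U (q i) xs (row i xq) &
        forall y, X y ->
          a0 xs + \sum_i lam 0 i * a i xs <=
          a0 y + \sum_i lam 0 i * a i y
          + dot (xp + \sum_i lam 0 i *: row i xq) (y - xs)].
Proof.
move=> oU cU cX XU ca0 ca cp cq Xxs xs_feas xs_min slater.
have [s [mu [T H]]] :=
  convex_program_perturbation oU cU cX XU ca0 ca cp cq xs_min slater.
have Uxs := XU _ Xxs.
pose lone (i : 'I_m) (z : 'rV[R]_n) : 'M[R]_(m, n) :=
  \matrix_j (if j == i then z else 0).
have row_lone i j z :
  row j (lone i z) = if j == i then z else 0 by rewrite rowK.
have sum_lone i (z : 'rV[R]_n) :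
    \sum_j dot (row j T) (row j (lone i z)) = dot (row i T) z.
  rewrite (bigD1 i) //= row_lone eqxx big1 ?addr0 // => j ji.
  by rewrite row_lone (negbTE ji) dot0r.
have sum0 : \sum_j dot (row j T) (row j (0 : 'M[R]_(m, n))) = 0.
  by apply: big1 => j _; rewrite linear0 dot0r.
have dot_mu i (t : R) : dot mu (\row_j (if j == i then t else 0)) = mu 0 i * t.
  rewrite /dot (bigD1 i) //= mxE eqxx big1 ?addr0 // => j ji.
  by rewrite mxE (negbTE ji) mulr0.
pose c i := a i xs + q i xs.
have mu_le i t : c i <= t -> mu 0 i * t <= 0.
  move=> ct; have := H xs 0 (\row_j (if j == i then t else 0)) 0.
  rewrite sum0 dot0r dot_mu !addr0 subrr add0r.
  apply=> // j; rewrite linear0 addr0 //.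
  by rewrite mxE; case: eqP => [->|_] //; exact: xs_feas.
have mu_npos i : mu 0 i <= 0.
  by have := mu_le i 1; rewrite mulr1; apply;
    apply: le_trans ler01; exact: xs_feas.
have mu_c i : mu 0 i * c i = 0.
  apply/eqP; rewrite eq_le mu_le //=.
  exact: mulr_le0 (mu_npos i) (xs_feas i).
have s_sub : subdiff U p xs s.
  move=> z Uz; have := H xs (z - xs) 0 0.
  rewrite sum0 dot0r !addr0 subrKC => h.
  suff : dot s (z - xs) <= a0 xs + p z - (a0 xs + p xs) by lra.
  by apply: h => // i; rewrite linear0 addr0 // mxE.
have T_sub i z : U z -> dot (row i T) (z - xs) <= (- mu 0 i) * (q i z - q i xs).
  move=> Uz.
  have := H xs 0 (\row_j (if j == i then a i xs + q i z else 0))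
    (lone i (z - xs)).
  rewrite sum_lone dot0r add0r dot_mu addr0 subrr => h.
  have := mu_c i; rewrite /c.
  suff : mu 0 i * (a i xs + q i z) + dot (row i T) (z - xs) <= 0 by lra.
  apply: h => // j; rewrite row_lone.
    by case: eqP => _; rewrite ?subrKC ?addr0.
  rewrite mxE; case: eqP => [->|_]; first by rewrite subrKC.
  by rewrite addr0; exact: xs_feas.
have /boolp.choice[xq xqP] i :
    exists t, subdiff U (q i) xs t /\ row i T = (- mu 0 i) *: t.
  apply: subdiff_scale_inv => //; last exact: T_sub.
  by rewrite oppr_ge0.
exists (- mu), s, (\matrix_i xq i); split=> //.
- by move=> i; rewrite mxE oppr_ge0.
- by move=> i; rewrite mxE mulNr mu_c oppr0.
- by move=> i; rewrite rowK; case: (xqP i).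
move=> y Xy.
have := H y (xs - y) (\row_j (a j y + q j xs)) (\matrix_j (xs - y)).
rewrite subrKC => h.
have {h} : dot s (xs - y) + dot mu (\row_j (a j y + q j xs)) +
    \sum_i dot (row i T) (xs - y) <= a0 y + p xs - (a0 xs + p xs).
  under [X in _ + X <= _]eq_bigr => i _ do
    rewrite -(rowK (fun=> xs - y) i).
  by apply: h => // i; rewrite rowK subrKC // mxE.
have -> : dot mu (\row_j (a j y + q j xs)) =
    \sum_i (- mu) 0 i * a i xs - \sum_i (- mu) 0 i * a i y.
  rewrite -sumrB; apply: eq_bigr => i _; rewrite !mxE.
  by have := mu_c i; rewrite /c; lra.
rewrite dotDl dot_suml.
have -> : \sum_i dot ((- mu) 0 i *: row i (\matrix_j xq j)) (y - xs) =
    - \sum_i dot (row i T) (xs - y).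
  rewrite -sumrN; apply: eq_bigr => i _.
  by rewrite rowK mxE -(xqP i).2 -dotNr opprB.
by rewrite -(opprB y xs) dotNr; lra.
Qed.

(** * Nonmonotone descent of a real sequence *)

(** The default value of the maximum is one of its terms, so the maximum is
    attained. *)
Definition window_max (R : realType) (F : nat -> R) (M k : nat) : R :=
  \big[Num.max/F k]_((k - M)%N <= i < k.+1) F i.

Lemma window_max_attained (R : realType) (F : nat -> R) M k :
  exists2 i, (k - M <= i <= k)%N & window_max F M k = F i.
Proof.
rewrite /window_max big_nat.
apply: (big_ind (fun a => exists2 i, (k - M <= i <= k)%N & a = F i))
  => [|a b [i ik ->] [j jk ->]|i ik].
- by exists k => //; rewrite leq_subr leqnn.
- by case: (leP (F i) (F j)) => _; [exists j | exists i].
- by exists i.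
Qed.

Lemma window_max_ge (R : realType) (F : nat -> R) M k i :
  (k - M <= i <= k)%N -> F i <= window_max F M k.
Proof.
move=> ik; rewrite /window_max.
by apply: Order.TotalTheory.le_bigmax_seq; rewrite // mem_index_iota ltnS.
Qed.

Section NonmonotoneDescent.
Variables (R : realType) (F d : nat -> R) (M : nat) (c : R).
Hypothesis c_gt0 : 0 < c.
Hypothesis d_ge0 : forall k, 0 <= d k.
Hypothesis descent :
  forall k, F k.+1 <= window_max F M k - c / 2 * d k ^+ 2.
Hypothesis small_step : forall e, 0 < e ->
  exists2 r, 0 < r & forall k, d k < r -> `|F k.+1 - F k| < e.
Hypothesis bounded : has_lbound (range (window_max F M)).

Local Notation W := (window_max F M).

(** The only term of the new window that is absent from the old one is the new
    value, which the descent condition puts below the old maximum. *)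
Lemma window_max_nonincreasing : {homo W : k l / (k <= l)%N >-> l <= k}.
Proof.
apply/nonincreasing_seqP => k.
have [i /andP[ki ik] ->] := window_max_attained F M k.+1.
move: ik; rewrite leq_eqVlt => /predU1P[->|ik]; last first.
  by apply: window_max_ge; lia.
apply: (le_trans (descent k)); rewrite gerBl.
by rewrite mulr_ge0 ?sqr_ge0 // divr_ge0 // ltW.
Qed.

Let Wbar := limn W.

Let W_cvg : W @ \oo --> Wbar.
Proof. exact: nonincreasing_is_cvgn window_max_nonincreasing bounded. Qed.

Let W_ge k : Wbar <= W k.
Proof.
apply: nonincreasing_cvgn_ge; first exact: window_max_nonincreasing.
exact: nonincreasing_is_cvgn window_max_nonincreasing bounded.
Qed.

Let W_near e : 0 < e -> exists N, forall k, (N <= k)%N -> W k < Wbar + e.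
Proof.
move=> e0.
have [N _ NP] : \forall k \near \oo, W k < Wbar + e.
  by apply: (cvgr_lt _ W_cvg); rewrite ltrDl.
by exists N => k; exact: NP.
Qed.

Let step_lt r : 0 < r -> forall k, W k - F k.+1 < c / 2 * r ^+ 2 -> d k < r.
Proof.
move=> r0 k h; rewrite ltNge; apply/negP => rd.
have : c / 2 * r ^+ 2 <= c / 2 * d k ^+ 2.
  apply: ler_wpM2l; first by rewrite divr_ge0 // ltW.
  by rewrite ler_sqr ?nnegrE //; exact: ltW.
by have := descent k; lra.
Qed.

(** A value F k.+1 close to Wbar leaves room in the descent condition only for a
    small d k, and a small step changes F only a little. *)
Lemma value_one_step_back e : 0 < e ->
  exists2 r, 0 < r & exists N, forall k, (N <= k)%N ->
    Wbar - r <= F k.+1 -> Wbar - e <= F k.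
Proof.
move=> e0; have e20 : 0 < e / 2 by rewrite divr_gt0.
have [s s0 hs] := small_step e20.
have a0 : 0 < c / 4 * s ^+ 2 by rewrite mulr_gt0 ?divr_gt0 // exprn_gt0.
have [N NP] := W_near a0.
exists (Num.min (e / 2) (c / 4 * s ^+ 2)); first by rewrite lt_min e20 a0.
exists N => k /NP Wk; rewrite lerBlDr => Fk1.
have /andP[ra rb] : (Num.min (e / 2) (c / 4 * s ^+ 2) <= e / 2) &&
  (Num.min (e / 2) (c / 4 * s ^+ 2) <= c / 4 * s ^+ 2).
  by rewrite !ge_min !lexx orbT.
have /hs : d k < s by apply: step_lt => //; lra.
by rewrite ltr_norml => /andP[_]; lra.
Qed.

(** The radius and the rank do not depend on the number j <= L of steps, because
    the position in the window where the maximum is attained is not known. *)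
Lemma value_steps_back L e : 0 < e ->
  exists2 r, 0 < r & exists N, forall k j, (N <= k)%N -> (j <= L)%N ->
    Wbar - r <= F (k + j)%N -> Wbar - e <= F k.
Proof.
elim: L e => [|L IH] e e0.
  by exists e => //; exists 0%N => k [|//]; rewrite addn0.
have [r r0 [N NP]] := value_one_step_back e0.
have [s s0 [N' NP']] := IH r r0.
exists (Num.min e s); first by rewrite lt_min e0 s0.
exists (maxn N N') => k j; rewrite geq_max => /andP[Nk N'k] jL hF.
have /andP[ra rb] : (Num.min e s <= e) && (Num.min e s <= s).
  by rewrite !ge_min !lexx orbT.
case: j jL hF => [_|j jL]; first by rewrite addn0; lra.
rewrite addnS -addSn => hF; apply: NP => //.
by apply: (NP' _ j) => //; [exact: leqW | lra].
Qed.

(** The window of length M + 1 starting at k contains an index where F is at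
    least Wbar; going back from there to k takes at most M steps. *)
Lemma nonmonotone_values_cvg : F @ \oo --> Wbar.
Proof.
apply/cvgrPdist_le => e e0.
have [r r0 [N NP]] := value_steps_back M e0.
have [N' NP'] := W_near e0.
exists (maxn N N') => // k /=; rewrite geq_max => /andP[Nk N'k].
have [i /andP[ik iM] Wi] := window_max_attained F M (k + M).
have ki : (k <= i)%N by move: ik; rewrite addnK.
have Fk : Wbar - e <= F k.
  apply: (NP _ (i - k)%N) => //; first by rewrite leq_subLR.
  by rewrite subnKC // -Wi; have := W_ge (k + M); lra.
have := @window_max_ge _ F M k k; rewrite leq_subr leqnn => /(_ isT).
by have := NP' k N'k; rewrite ler_norml => *; apply/andP; split; lra.
Qed.

Lemma nonmonotone_steps_cvg0 : d @ \oo --> (0 : R).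
Proof.
apply/cvgrPdist_lt => e e0.
have a0 : 0 < c / 4 * e ^+ 2 by rewrite mulr_gt0 ?divr_gt0 // exprn_gt0.
have [N NP] := W_near a0.
have [N' _ NP'] : \forall k \near \oo, Wbar - c / 4 * e ^+ 2 < F k.
  by apply: (cvgr_gt _ nonmonotone_values_cvg); rewrite gtrBl.
exists (maxn N N') => // k /=; rewrite geq_max => /andP[Nk N'k].
rewrite sub0r normrN ger0_norm //; apply: step_lt => //.
by have := NP k Nk; have := NP' k.+1 (leqW N'k); lra.
Qed.

End NonmonotoneDescent.

(** * Passing to the limit *)

(** The balls of radius 1 / (j + 1) form a neighbourhood basis, and the cluster
    point property is used against the tail of the sequence after j. *)
Lemma cluster_subsequence (R : realType) (T : pseudoMetricType R)
    (z : nat -> T) (a : T) :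
  cluster (z @ \oo) a ->
  exists2 k : nat -> nat, (forall j, (j <= k j)%N) & z (k j) @[j --> \oo] --> a.
Proof.
move=> cl.
have /boolp.choice[k kP] j : exists i, (j <= i)%N /\ ball a j.+1%:R^-1 (z i).
  have Fz : (z @ \oo) (z @` [set i | (j <= i)%N]).
    by exists j => // i ji; exists i.
  have r0 : 0 < j.+1%:R^-1 :> R by rewrite invr_gt0.
  have [_ [[i ji <-] zi]] := cl _ _ Fz (nbhsx_ballx a _ r0).
  by exists i.
exists k; first by move=> j; case: (kP j).
apply/cvg_ballP => e e0.
have near_e : \forall j \near \oo, j.+1%:R^-1 <= e.
  by have /cvgrPdist_le/(_ e e0) := @cvg_harmonic R;
    apply: filterS => j; rewrite sub0r normrN /harmonic /= ger0_norm ?invr_ge0.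
by apply: filterS near_e => j je; apply: le_ball je _ _; case: (kP j).
Qed.

Lemma cvg_split_pair (T U V : topologicalType) (F : set_system T) {FF : Filter F}
    (u : T -> U * V) (a : U) (b : V) :
  u @ F --> (a, b) ->
  (u x).1 @[x --> F] --> a /\ (u x).2 @[x --> F] --> b.
Proof.
move=> h; split.
  exact: (@cvg_comp _ _ _ u fst F (nbhs (a, b)) (nbhs a) h
    (@cvg_fst _ _ (nbhs a) (nbhs b) _)).
exact: (@cvg_comp _ _ _ u snd F (nbhs (a, b)) (nbhs b) h
  (@cvg_snd _ _ (nbhs a) (nbhs b) _)).
Qed.

Lemma cvg_normB_le (R : realType) (W : normedModType R) (T : Type)
    (F : set_system T) {FF : Filter F} (w : T -> W) (b : W) (r : T -> R) :
  (forall t, `|w t - b| <= r t) -> r t @[t --> F] --> (0 : R) ->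
  w t @[t --> F] --> b.
Proof.
move=> wr r0; apply/cvgrPdist_le => e e0.
apply: filterS (cvgr0_norm_le _ r0 _ e0) => t rt; apply: le_trans rt.
by rewrite distrC (le_trans (wr t)) // ler_norm.
Qed.

Lemma cvg_dist0 (R : realType) (W : normedModType R) (T : Type)
    (F : set_system T) {FF : Filter F} (w : T -> W) (b : W) :
  w t @[t --> F] --> b -> `|w t - b| @[t --> F] --> (0 : R).
Proof.
move=> wb; rewrite -(@normr0 _ W) -(subrr b).
by apply: cvg_norm; apply: cvgB => //; exact: cvg_cst.
Qed.

Lemma cvg_coord (R : realType) k n (T : Type) (F : set_system T) {FF : Filter F}
    (A : T -> 'M[R]_(k, n)) (B : 'M[R]_(k, n)) i j :
  A t @[t --> F] --> B -> A t i j @[t --> F] --> B i j.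
Proof. move=> AB; exact: (@cvg_comp _ _ _ A (fun M : 'M[R]_(k, n) => M i j)
  F (nbhs B) (nbhs (B i j)) AB (@coord_continuous R k n i j B)). Qed.

Lemma cvg_row (R : realType) k n (T : Type) (F : set_system T) {FF : Filter F}
    (A : T -> 'M[R]_(k, n)) (B : 'M[R]_(k, n)) i :
  A t @[t --> F] --> B -> row i (A t) @[t --> F] --> row i B.
Proof.
move=> AB; apply: (cvg_normB_le _ (cvg_dist0 AB)) => t.
rewrite -linearB [leLHS]mx_normrE; apply: bigmax_le => // -[i' j] _ /=.
by rewrite mxE; exact: coord_le_norm.
Qed.

Lemma cvg_dot (R : realType) n (T : Type) (F : set_system T) {FF : Filter F}
    (a b : T -> 'rV[R]_n) (a' b' : 'rV[R]_n) :
  a t @[t --> F] --> a' -> b t @[t --> F] --> b' ->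
  dot (a t) (b t) @[t --> F] --> dot a' b'.
Proof.
move=> ha hb; apply: cvg_big => [|j _]; first exact: add_continuous.
by apply: cvgM; exact: cvg_coord.
Qed.

Lemma enorm_sqr (R : realType) n (a : 'rV[R]_n) : enorm a ^+ 2 = dot a a.
Proof. by rewrite sqr_sqrtr // dot_ge0. Qed.

Lemma norm_le_enorm (R : realType) n (a : 'rV[R]_n) : `|a| <= enorm a.
Proof.
rewrite [leLHS]mx_normrE; apply: bigmax_le => [|[i j] _ /=].
  exact: sqrtr_ge0.
rewrite -sqrtr_sqr ler_sqrt ?dot_ge0 // ord1 /dot (bigD1 j) //= expr2 lerDl.
by apply: sumr_ge0 => l _; rewrite -expr2 sqr_ge0.
Qed.

Lemma cvg_enorm0 (R : realType) n (T : Type) (F : set_system T) {FF : Filter F}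
    (a : T -> 'rV[R]_n) (b : 'rV[R]_n) :
  a t @[t --> F] --> b -> enorm (a t - b) @[t --> F] --> (0 : R).
Proof.
move=> ab.
have ab0 : a t - b @[t --> F] --> (0 : 'rV[R]_n).
  by rewrite -(subrr b); apply: cvgB => //; exact: cvg_cst.
rewrite -(sqrtr0 R) -(dot0r (0 : 'rV[R]_n)).
by apply: (continuous_cvg _ (@sqrt_continuous R _)); exact: cvg_dot.
Qed.

Lemma cvg_grad (R : realType) n (A : set 'rV[R]_n) (h : 'rV[R]_n -> R)
    (T : Type) (F : set_system T) {FF : Filter F}
    (x : T -> 'rV[R]_n) (xs : 'rV[R]_n) :
  lipschitz_gradient_on A h -> (forall t, A (x t)) -> A xs ->
  x t @[t --> F] --> xs -> grad h (x t) @[t --> F] --> grad h xs.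
Proof.
move=> [L L0 hL] Ax Axs xxs.
apply: (@cvg_normB_le _ _ _ _ _ _ _ (fun t => L * enorm (x t - xs))) => [t|].
  by apply: (le_trans (norm_le_enorm _)); exact: hL.
by rewrite -(mulr0 L); apply: cvgM; [exact: cvg_cst | exact: cvg_enorm0].
Qed.

Lemma subdiff_closed (R : realType) n (U : set 'rV[R]_n) (h : 'rV[R]_n -> R)
    (x s : nat -> 'rV[R]_n) (xs ss : 'rV[R]_n) :
  (forall j, subdiff U h (x j) (s j)) ->
  x j @[j --> \oo] --> xs -> s j @[j --> \oo] --> ss ->
  h (x j) @[j --> \oo] --> h xs -> subdiff U h xs ss.
Proof.
move=> hs xxs sss hxs y Uy.
apply: (@ler_cvg_to _ \oo _ _ (fun j => h (x j) + dot (s j) (y - x j))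
  (fun=> h y)).
- apply: cvgD => //; apply: cvg_dot => //.
  by apply: cvgB => //; exact: cvg_cst.
- exact: cvg_cst.
- by apply: nearW => j; exact: hs.
Qed.

(** Lets a convexity estimate known on a half-open segment pass to the end point
    left out. *)
Lemma le_of_segment (R : realType) (a b d : R) :
  (forall t, 0 < t <= 1 -> d <= t * a + (1 - t) * b) -> d <= b.
Proof.
move=> h; apply/ler_addgt0Pr => e e0.
have B0 : 0 < `|a - b| + 1 by rewrite ltr_pwDr.
(* then t (a - b) <= e *)
pose t := Num.min 1 (e / (`|a - b| + 1)).
have t0 : 0 < t by rewrite lt_min ltr01 divr_gt0.
have t1 : t <= 1 by rewrite ge_min lexx.
have te : t * (`|a - b| + 1) <= e by rewrite -ler_pdivlMr // ge_min lexx orbT.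
have := h t; rewrite t0 t1 => /(_ isT).
have : t * (a - b) <= t * `|a - b| by rewrite ler_pM2l // ler_norm.
lra.
Qed.

(** * The convex models *)

(** The common convex quadratic part of the model objective and of the model
    constraints: the models are obtained from it by adding p or q_i. *)
Definition quad_part (R : realType) n (h w : 'rV[R]_n -> R) (x : 'rV[R]_n)
    (l : R) (s t : 'rV[R]_n) (y : 'rV[R]_n) : R :=
  h x + dot s (y - x) + l / 2 * enorm (y - x) ^+ 2 - (w x + dot t (y - x)).

Lemma model_constrE (R : realType) n m (P : dc_problem R n m) x lg sg sv i y :
  model_constr P x lg sg sv i y =
  quad_part (g P i) (v P i) x (lg 0 i) (row i sg) (row i sv) y + q P i y.
Proof. by rewrite /model_constr /quad_part; ring. Qed.

Lemma model_objE (R : realType) n m (P : dc_problem R n m) x lf sf su y :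
  model_obj P x lf sf su y = quad_part (f P) (u P) x lf sf su y + p P y.
Proof. by rewrite /model_obj /quad_part; ring. Qed.

Lemma quad_part_center (R : realType) n (h w : 'rV[R]_n -> R) x l s t :
  quad_part h w x l s t x = h x - w x.
Proof. by rewrite /quad_part enorm_sqr subrr !dot0r; ring. Qed.

Lemma quad_part_convex (R : realType) n (A : set 'rV[R]_n)
    (h w : 'rV[R]_n -> R) x l s t :
  0 <= l -> convex_function A (quad_part h w x l s t).
Proof.
move=> l0; apply/convex_functionP => y z a _ _ /andP[a0 a1].
have -> : quad_part h w x l s t (a *: y + (1 - a) *: z) =
    a * quad_part h w x l s t y + (1 - a) * quad_part h w x l s t z -
    l / 2 * (a * (1 - a)) * dot (y - z) (y - z).
  (* both sides are quadratic in d = y - z and e = z - x *)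
  have yE : y = (y - z) + z by rewrite subrK.
  rewrite /quad_part !enorm_sqr; move: (y - z) yE => d ->.
  have -> : a *: (d + z) + (1 - a) *: z - x = a *: d + (z - x).
    by rewrite scalerDr -(addrA (a *: d)) combxx addrA.
  rewrite -[d + z - x]addrA; move: (z - x) => e.
  rewrite !(dotDr, dotDl, dotZr, dotZl) (dotC e d).
  by move: (l / 2) => k; ring.
by rewrite gerBl !mulr_ge0 ?dot_ge0 ?invr_ge0 // subr_ge0.
Qed.

Lemma cvg_quad_part (R : realType) n (h w : 'rV[R]_n -> R)
    (x s t y : nat -> 'rV[R]_n) (l : nat -> R) (xs ss ts ys : 'rV[R]_n) ls :
  x j @[j --> \oo] --> xs -> l j @[j --> \oo] --> ls ->
  s j @[j --> \oo] --> ss -> t j @[j --> \oo] --> ts ->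
  y j @[j --> \oo] --> ys ->
  h (x j) @[j --> \oo] --> h xs -> w (x j) @[j --> \oo] --> w xs ->
  quad_part h w (x j) (l j) (s j) (t j) (y j) @[j --> \oo] -->
  quad_part h w xs ls ss ts ys.
Proof.
move=> xxs lls sss tts yys hxs wxs; rewrite /quad_part.
have yx : y j - x j @[j --> \oo] --> ys - xs by exact: cvgB.
rewrite enorm_sqr; under eq_cvg => j do rewrite enorm_sqr.
apply: cvgB; last by apply: cvgD => //; exact: cvg_dot.
apply: cvgD; first by apply: cvgD => //; exact: cvg_dot.
apply: cvgM; last exact: cvg_dot.
by apply: cvgM => //; exact: cvg_cst.
Qed.

(** * Limits of the method *)

Lemma cvg_value (R : realType) n (h : 'rV[R]_n -> R) (x : nat -> 'rV[R]_n)
    (xs : 'rV[R]_n) :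
  h y @[y --> xs] --> h xs -> x j @[j --> \oo] --> xs ->
  h (x j) @[j --> \oo] --> h xs.
Proof.
by move=> hc xxs; exact: (@cvg_comp _ _ _ x h \oo (nbhs xs) (nbhs (h xs)) xxs hc).
Qed.

Lemma cvg_differentiable (R : realType) n (h : 'rV[R]_n -> R) (xs : 'rV[R]_n) :
  differentiable (h : 'rV[R]_n -> R^o) xs -> h y @[y --> xs] --> h xs.
Proof. exact: differentiable_continuous. Qed.

(** Whatever the number of passes, only the last one matters, and multiplying by
    tau keeps the curvatures nonnegative, which is what convexity of the models
    requires. *)
Lemma scp_inner_final (R : realType) n m (P : dc_problem R n m) c tau M x k
    sf su sg sv lf lg lf' lg' y :
  0 <= tau ->
  scp_inner P c tau M x k sf su sg sv lf lg lf' lg' y ->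
  0 <= lf -> (forall i, 0 <= lg 0 i) ->
  [/\ argmin (model_set P (x k) lg' sg sv) (model_obj P (x k) lf' sf su) y,
      feasible P y, nonmonotone_decrease P c M x k y,
      0 <= lf' & forall i, 0 <= lg' 0 i].
Proof.
move=> tau0; elim=> [||] {lf lg lf' lg' y} //.
- move=> lf lg y lf' lg' y' _ _ _ IH lf0 lg0; apply: IH => // i.
  by rewrite mxE mulr_ge0.
- move=> lf lg y lf' lg' y' _ _ _ _ IH lf0 lg0.
  by apply: IH => //; exact: mulr_ge0.
Qed.

(** A point z that satisfies the limit constraints with equality need not be
    feasible for any of the approximating models; a point of the segment from z
    to the Slater point is, for large j, and it can be taken arbitrarily close
    to z. *)
Lemma model_argmin_limit (R : realType) n m (P : dc_problem R n m)
    (x y : nat -> 'rV[R]_n) (lf : nat -> R) (lg : nat -> 'rV[R]_m)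
    (sf su : nat -> 'rV[R]_n) (sg sv : nat -> 'M[R]_(m, n))
    (xs : 'rV[R]_n) (lfs : R) (lgs : 'rV[R]_m) (sfs sus : 'rV[R]_n)
    (sgs svs : 'M[R]_(m, n)) (z : 'rV[R]_n) :
  standing_assumptions P ->
  x j @[j --> \oo] --> xs -> y j @[j --> \oo] --> xs ->
  lf j @[j --> \oo] --> lfs -> lg j @[j --> \oo] --> lgs ->
  sf j @[j --> \oo] --> sfs -> su j @[j --> \oo] --> sus ->
  sg j @[j --> \oo] --> sgs -> sv j @[j --> \oo] --> svs ->
  (forall j, argmin (model_set P (x j) (lg j) (sg j) (sv j))
     (model_obj P (x j) (lf j) (sf j) (su j)) (y j)) ->
  X P xs -> 0 <= lfs -> (forall i, 0 <= lgs 0 i) ->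
  model_slater P xs lgs sgs svs ->
  model_set P xs lgs sgs svs z ->
  model_obj P xs lfs sfs sus xs <= model_obj P xs lfs sfs sus z.
Proof.
move=> hP xxs yxs lflfs lglgs sfs_ sus_ sgs_ svs_ ymin Xxs lfs0 lgs0.
move=> [w Xw w_lt] [Xz z_le].
have Uxs := X_sub_U hP Xxs.
have cx h : convex_function (U P) h -> h v @[v --> xs] --> h xs.
  move=> ch.
  by apply: convex_continuous ch Uxs; [exact: U_open | exact: U_convex].
have f_cvg := cvg_value (cvg_differentiable (f_differentiable hP Xxs)) xxs.
have g_cvg i := cvg_value (cvg_differentiable (g_differentiable hP i Xxs)) xxs.
have u_cvg := cvg_value (cx _ (u_convex hP)) xxs.
have v_cvg i := cvg_value (cx _ (v_convex hP i)) xxs.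
have p_cvg := cvg_value (cx _ (p_convex hP)) yxs.
apply: (@le_of_segment _ (model_obj P xs lfs sfs sus w)) => t t01.
have {t01} [t0 t01] : 0 < t /\ 0 <= t <= 1.
  by case/andP: t01 => t0 t1; rewrite t0 t1 ltW.
have /andP[_ t1] := t01.
pose a := t *: w + (1 - t) *: z.
have Xa : X P a by apply: convex_setP => //; exact: X_convex.
have seg h r k l s s' : convex_function (U P) r -> 0 <= l ->
    quad_part h k xs l s s' a + r a <=
    t * (quad_part h k xs l s s' w + r w) +
    (1 - t) * (quad_part h k xs l s s' z + r z).
  move=> /convex_functionP cr l0.
  have := cr _ _ _ (X_sub_U hP Xw) (X_sub_U hP Xz) t01.
  have /convex_functionP cq := @quad_part_convex _ _ (X P) h k xs l s s' l0.
  by have := cq _ _ _ Xw Xz t01; rewrite -/a; lra.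
have a_lt i : model_constr P xs lgs sgs svs i a < 0.
  have := z_le i; have := w_lt i; rewrite !model_constrE => wi zi.
  apply: (le_lt_trans (seg _ _ _ _ _ _ (q_convex hP i) (lgs0 i))).
  have : t * (quad_part (g P i) (v P i) xs (lgs 0 i) (row i sgs) (row i svs) w
    + q P i w) < 0 by rewrite pmulr_rlt0.
  have : (1 - t) * (quad_part (g P i) (v P i) xs (lgs 0 i) (row i sgs)
    (row i svs) z + q P i z) <= 0 by rewrite mulr_ge0_le0 // subr_ge0.
  lra.
have a_near : \forall j \near \oo,
    forall i, model_constr P (x j) (lg j) (sg j) (sv j) i a < 0.
  apply: (@filter_forall _ _ (fun i j =>
    model_constr P (x j) (lg j) (sg j) (sv j) i a < 0) \oo) => i.
  have lim : model_constr P (x j) (lg j) (sg j) (sv j) i a @[j --> \oo] -->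
      model_constr P xs lgs sgs svs i a.
    rewrite model_constrE; under eq_cvg => j do rewrite model_constrE.
    apply: cvgD; last exact: cvg_cst.
    apply: cvg_quad_part => //; [exact: cvg_coord | exact: cvg_row
      | exact: cvg_row | exact: cvg_cst].
  exact: (cvgr_lt _ lim).
have obj_lim (b : nat -> 'rV[R]_n) bs : b j @[j --> \oo] --> bs ->
    p P (b j) @[j --> \oo] --> p P bs ->
    model_obj P (x j) (lf j) (sf j) (su j) (b j) @[j --> \oo] -->
    model_obj P xs lfs sfs sus bs.
  move=> bbs pb; rewrite model_objE; under eq_cvg => j do rewrite model_objE.
  by apply: cvgD => //; exact: cvg_quad_part.
apply: (@le_trans _ _ (model_obj P xs lfs sfs sus a)).
  apply: (ler_cvg_to (obj_lim _ _ yxs p_cvg)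
    (obj_lim (fun=> a) a (cvg_cst _) (cvg_cst _))).
  apply: filterS a_near => j ja; apply: (ymin j).2; split=> // i.
  exact: ltW.
by rewrite !model_objE; apply: seg => //; exact: p_convex.
Qed.

(** The convex optimality condition at xs reads
    0 <= <s, y - xs> + k |y - xs|^2 for y in X, with s the vector of the KKT
    inclusion.  At distance t along the segment towards y the quadratic term is
    of order t^2, so it can be dropped: - s is a normal vector. *)
Lemma model_minimizer_is_KKT (R : realType) n m (P : dc_problem R n m)
    (xs : 'rV[R]_n) (lfs : R) (lgs : 'rV[R]_m) (sfs sus : 'rV[R]_n)
    (sgs svs : 'M[R]_(m, n)) :
  standing_assumptions P -> feasible P xs ->
  sfs = grad (f P) xs -> (forall i, row i sgs = grad (g P i) xs) ->
  subdiff (U P) (u P) xs sus ->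
  (forall i, subdiff (U P) (v P i) xs (row i svs)) ->
  0 <= lfs -> (forall i, 0 <= lgs 0 i) ->
  model_slater P xs lgs sgs svs ->
  (forall z, model_set P xs lgs sgs svs z ->
     model_obj P xs lfs sfs sus xs <= model_obj P xs lfs sfs sus z) ->
  is_KKT P xs.
Proof.
move=> hP xs_feas sfsE sgsE sus_sub svs_sub lfs0 lgs0 [w Xw w_lt] xs_min.
have [Xxs xs_le] := xs_feas.
pose a i := quad_part (g P i) (v P i) xs (lgs 0 i) (row i sgs) (row i svs).
pose a0 := quad_part (f P) (u P) xs lfs sfs sus.
have constrE i : a i xs + q P i xs = constr P i xs.
  by rewrite /a quad_part_center /constr; ring.
have a_feas i : a i xs + q P i xs <= 0 by rewrite constrE.
have a_min y : X P y -> (forall i, a i y + q P i y <= 0) ->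
    a0 xs + p P xs <= a0 y + p P y.
  move=> Xy y_le; rewrite -!model_objE; apply: xs_min; split=> // i.
  by rewrite model_constrE; exact: y_le.
have a_slater : exists2 y, X P y & forall i, a i y + q P i y < 0.
  by exists w => // i; rewrite -model_constrE.
have [lam [xp [xq [lam0 compl xp_sub xq_sub opt]]]] :=
  convex_program_multipliers (U_open hP) (U_convex hP) (X_convex hP)
    (X_sub_U hP) (@quad_part_convex _ _ _ (f P) (u P) xs lfs sfs sus lfs0)
    (fun i => @quad_part_convex _ _ _ (g P i) (v P i) xs (lgs 0 i)
       (row i sgs) (row i svs) (lgs0 i))
    (p_convex hP) (q_convex hP) Xxs a_feas a_min a_slater.
split=> //; exists lam; split=> //; last by move=> i; rewrite -constrE.
pose s := sfs + xp - sus + \sum_i lam 0 i *: (row i sgs + row i xq - row i svs).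
exists xp, sus, xq, svs, (- s); split=> //; last first.
  rewrite -sfsE; under eq_bigr => i _ do rewrite -sgsE.
  by rewrite subrr.
move=> y Xy; rewrite dotNl oppr_le0.
(* the part coming from the quadratic models, and the subgradients found
   by duality *)
have sE : s = (sfs - sus) + \sum_i lam 0 i *: (row i sgs - row i svs) +
    (xp + \sum_i lam 0 i *: row i xq).
  rewrite /s [sfs + xp - sus]addrAC -!addrA; congr (_ + (_ + _)).
  rewrite [RHS]addrCA -big_split; congr (_ + _); apply: eq_bigr => i _ /=.
  by rewrite -scalerDr addrAC.
pose k := lfs / 2 + \sum_i lam 0 i * (lgs 0 i / 2).
apply: (@le_of_segment _ (dot s (y - xs) + k * dot (y - xs) (y - xs))) => t t01.
have /andP[t0 t1] := t01.
pose b := t *: y + (1 - t) *: xs.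
have bE : b - xs = t *: (y - xs).
  by rewrite /b scalerBl scale1r addrAC addrA subrK scalerBr.
have Xb : X P b.
  by apply: convex_setP => //; [exact: X_convex | rewrite ltW].
have quadB h r l c d : quad_part h r xs l c d b - quad_part h r xs l c d xs =
    t * dot (c - d) (y - xs) + l / 2 * (t * (t * dot (y - xs) (y - xs))).
  rewrite quad_part_center /quad_part enorm_sqr bE !(dotDl, dotNl, dotZr, dotZl).
  ring.
have := opt b Xb; rewrite -subr_ge0.
have -> : a0 b + \sum_i lam 0 i * a i b
    + dot (xp + \sum_i lam 0 i *: row i xq) (b - xs)
    - (a0 xs + \sum_i lam 0 i * a i xs) =
    t * (dot s (y - xs) + t * (k * dot (y - xs) (y - xs))).
  have -> : a0 b + \sum_i lam 0 i * a i b
      + dot (xp + \sum_i lam 0 i *: row i xq) (b - xs)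
      - (a0 xs + \sum_i lam 0 i * a i xs) =
      (a0 b - a0 xs) + (\sum_i lam 0 i * a i b - \sum_i lam 0 i * a i xs)
      + dot (xp + \sum_i lam 0 i *: row i xq) (b - xs) by ring.
  rewrite quadB -sumrB bE dotZr.
  rewrite (eq_bigr (fun i => t * (lam 0 i * dot (row i sgs - row i svs) (y - xs))
    + (lam 0 i * (lgs 0 i / 2)) * (t * (t * dot (y - xs) (y - xs))))); last first.
    by move=> i _; rewrite -mulrBr quadB; ring.
  rewrite big_split /= -mulr_sumr -mulr_suml sE !(dotDl, dotNl).
  rewrite (dot_suml (fun i => lam 0 i *: (row i sgs - row i svs))).
  under [X in _ = t * (_ + X + _ + _)]eq_bigr => i _ do rewrite dotZl.
  by rewrite /k; ring.
rewrite pmulr_rge0 //; lra.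
Qed.

Unset Implicit Arguments.

Theorem theorem3p10 (R : realType) (n m : nat) (P : dc_problem R n m)
    (hP : standing_assumptions P)
    (c Lmin Lmax tau : R) (M : nat)
    (hc : 0 < c) (hLmin : 0 < Lmin) (hLmax : Lmin < Lmax) (htau : 1 < tau)
    (x : nat -> 'rV[R]_n) (lf : nat -> R) (lg : nat -> 'rV[R]_m)
    (sf su : nat -> 'rV[R]_n) (sg sv : nat -> 'M[R]_(m, n))
    (hseq : scp_sequence P c Lmin Lmax tau M x lf lg sf su sg sv)
    (hF : unif_continuous_on (level_set P (x 0%N)) (objective P))
    (xs : 'rV[R]_n) (lfs : R) (lgs : 'rV[R]_m)
    (sfs sus : 'rV[R]_n) (sgs svs : 'M[R]_(m, n))
    (hacc : cluster
       ((fun k : nat => (x k, lf k, lg k, sf k, su k, sg k, sv k)) @ \oo)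
       (xs, lfs, lgs, sfs, sus, sgs, svs)) :
  ((fun k : nat => enorm (x k.+1 - x k)) @ \oo --> (0 : R) /\
   (fun k : nat => objective P (x k)) @ \oo --> objective P xs) /\
  (model_slater P xs lgs sgs svs -> is_KKT P xs).
Proof.
have tau0 : 0 <= tau by lra.
have step k : [/\ argmin (model_set P (x k) (lg k) (sg k) (sv k))
    (model_obj P (x k) (lf k) (sf k) (su k)) (x k.+1),
    feasible P (x k.+1), nonmonotone_decrease P c M x k (x k.+1),
    0 <= lf k & forall i, 0 <= lg k 0 i].
  have [lf0 [lg0 [/andP[lf0_ge _] lg0_in inner]]] := scp_step hseq k.
  apply: (scp_inner_final tau0 inner); first exact: le_trans (ltW hLmin) lf0_ge.
  by move=> i; have /andP[h _] := lg0_in i; exact: le_trans (ltW hLmin) h.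
have feas k : feasible P (x k).
  by case: k => [|k]; [exact: scp_init hseq | case: (step k)].
have Xx k : X P (x k) by case: (feas k).
pose F k := objective P (x k).
pose d k := enorm (x k.+1 - x k).
have d_ge0 k : 0 <= d k by exact: sqrtr_ge0.
have descent k : F k.+1 <= window_max F M k - c / 2 * d k ^+ 2.
  by case: (step k).
have level k : level_set P (x 0%N) (x k).
  split=> //; apply: (@le_trans _ _ (window_max F M k)).
    by apply: window_max_ge; rewrite leq_subr leqnn.
  apply: (@le_trans _ _ (window_max F M 0)).
    exact: (window_max_nonincreasing hc descent).
  have [i /andP[_]] := window_max_attained F M 0.
  by rewrite leqn0 => /eqP-> ->.
have small_step e : 0 < e ->
    exists2 r, 0 < r & forall k, d k < r -> `|F k.+1 - F k| < e.
  by move=> /hF[r r0 hr]; exists r => // k dk; exact: hr.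
have [k k_ge] := cluster_subsequence hacc.
move=> /cvg_split_pair[/cvg_split_pair[/cvg_split_pair[/cvg_split_pair[
  /cvg_split_pair[/cvg_split_pair[/= x_cvg lf_cvg] lg_cvg] sf_cvg] su_cvg]
  sg_cvg] sv_cvg].
have k_cvg : k @ \oo --> \oo.
  move=> A [N _ NA]; exists N => // j /= Nj.
  by apply: NA => /=; exact: leq_trans Nj (k_ge j).
have Xxs : X P xs.
  apply: (@closed_cvg _ _ \oo _ (x \o k) (X P) (X_closed hP) _ xs x_cvg).
  by apply: nearW => j; exact: Xx.
have Uxs := X_sub_U hP Xxs.
have cx h : convex_function (U P) h -> h (x (k j)) @[j --> \oo] --> h xs.
  move=> ch; apply: cvg_value x_cvg.
  by apply: convex_continuous ch Uxs; [exact: U_open | exact: U_convex].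
have f_cvg := cvg_value (cvg_differentiable (f_differentiable hP Xxs)) x_cvg.
have g_cvg i := cvg_value (cvg_differentiable (g_differentiable hP i Xxs)) x_cvg.
have F_sub : F (k j) @[j --> \oo] --> objective P xs.
  apply: cvgB; last exact: cx (u_convex hP).
  by apply: cvgD => //; exact: cx (p_convex hP).
have xs_feas : feasible P xs.
  split=> // i.
  apply: (@ler_cvg_to _ \oo _ _ (fun j => constr P i (x (k j))) (fun=> 0)).
  - apply: cvgB; last exact: cx (v_convex hP i).
    by apply: cvgD => //; exact: cx (q_convex hP i).
  - exact: cvg_cst.
  - by apply: nearW => j; case: (feas (k j)).
have bounded : has_lbound (range (window_max F M)).
  exists (objective P xs) => _ [l _ <-].
  apply: (@ler_cvg_to _ \oo _ _ (fun j => F (k j))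
    (fun=> window_max F M l)) => //.
    exact: cvg_cst.
  exists l => // j /= lj; apply: (@le_trans _ _ (window_max F M (k j))).
    by apply: window_max_ge; rewrite leq_subr leqnn.
  apply: (window_max_nonincreasing hc descent).
  exact: leq_trans lj (k_ge j).
have d_cvg := nonmonotone_steps_cvg0 hc d_ge0 descent small_step bounded.
have F_cvg := nonmonotone_values_cvg hc d_ge0 descent small_step bounded.
have F_cvg_xs : F @ \oo --> objective P xs.
  have F_sub' := @cvg_comp _ _ _ k F \oo \oo _ k_cvg F_cvg.
  by rewrite -(cvg_unique _ F_sub' F_sub).
split=> // slater.
have xS_cvg : x (k j).+1 @[j --> \oo] --> xs.
  apply: (@cvg_normB_le _ _ _ _ _ _ _ (fun j => d (k j) + `|x (k j) - xs|)).
    move=> j.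
    have -> : x (k j).+1 - xs = (x (k j).+1 - x (k j)) + (x (k j) - xs).
      by rewrite addrA subrK.
    apply: (le_trans (ler_normD _ _)).
    by apply: lerD => //; exact: norm_le_enorm.
  rewrite -(addr0 0); apply: cvgD; last exact: cvg_dist0.
  exact: (@cvg_comp _ _ _ k d \oo \oo _ k_cvg d_cvg).
have lfs0 : 0 <= lfs.
  apply: (ler_cvg_to (cvg_cst 0) lf_cvg).
  by apply: nearW => j; case: (step (k j)).
have lgs0 i : 0 <= lgs 0 i.
  apply: (@ler_cvg_to _ \oo _ _ (fun=> 0) (fun j => lg (k j) 0 i)).
  - exact: cvg_cst.
  - exact: cvg_coord.
  - by apply: nearW => j; case: (step (k j)).
have sfsE : sfs = grad (f P) xs.
  have h : sf (k j) @[j --> \oo] --> grad (f P) xs.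
    under eq_cvg => j do rewrite (scp_sf hseq).
    exact: cvg_grad (f_lipschitz hP) (fun j => Xx (k j)) Xxs x_cvg.
  exact: (cvg_unique (@norm_hausdorff R 'rV[R]_n) sf_cvg h).
have sgsE i : row i sgs = grad (g P i) xs.
  have h : row i (sg (k j)) @[j --> \oo] --> grad (g P i) xs.
    under eq_cvg => j do rewrite (scp_sg hseq).
    exact: cvg_grad (g_lipschitz hP i) (fun j => Xx (k j)) Xxs x_cvg.
  have h' : row i (sg (k j)) @[j --> \oo] --> row i sgs by exact: cvg_row.
  exact: (cvg_unique (@norm_hausdorff R 'rV[R]_n) h' h).
have sus_sub : subdiff (U P) (u P) xs sus.
  apply: (subdiff_closed _ x_cvg su_cvg (cx _ (u_convex hP))) => j.
  exact: scp_su hseq (k j).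
have svs_sub i : subdiff (U P) (v P i) xs (row i svs).
  have h : row i (sv (k j)) @[j --> \oo] --> row i svs by exact: cvg_row.
  apply: (subdiff_closed _ x_cvg h (cx _ (v_convex hP i))) => j.
  exact: scp_sv hseq (k j) i.
apply: (model_minimizer_is_KKT hP xs_feas sfsE sgsE sus_sub svs_sub lfs0 lgs0
  slater) => z hz.
apply: (model_argmin_limit hP x_cvg xS_cvg lf_cvg lg_cvg sf_cvg su_cvg sg_cvg
  sv_cvg _ Xxs lfs0 lgs0 slater hz) => j.
by case: (step (k j)).
Qed.
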